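(* Let $m,c$ be fixed positive integers. For each $n\ge1$ let $\xi_n$ be the number of non-zero-blocks of a $(c,m)$-colored $B_n$-partition chosen uniformly at random, and let $E_n$ and $V_n$ be the expectation and variance of $\xi_n$. Then $(\xi_n-E_n)/\sqrt{V_n}$ converges in distribution to the standard normal distribution as $n\to\infty$.
   Context: Let $n,m,c$ be positive integers, let $C_1$ be a list of $c$ colors and $C_2$ a list of $m$ colors. A $(c,m)$-colored $B_n$-partition is a set partition $\pi$ of $[n]\cup\{0\}$ together with a coloring of the elements of $[n]$ defined as follows. For $x\in[n]\cup\{0\}$ let $b_x$ be the block of $\pi$ containing $x$. The block $b_0$ is called the zero-block, and every other block is a non-zero-block. Each $x\in[n]$ receives a color according to these rules: if $x=\min b_x$, then $x$ gets the first color of $C_2$; if $x\ne\min b_x$ and $x\in b_0$, then $x$ gets an arbitrary color from $C_1$; if $x\ne \min b_x$ and $x\notin b_0$, then $x$ gets an arbitrary color from $C_2$. Two such objects are equal exactly when they have the same underlying partition and the same coloring. *)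

(* Defs.v *)
From HB Require Import structures.
From mathcomp Require Import all_boot all_order all_algebra.
From mathcomp Require Import all_classical all_reals all_analysis.
From mathcomp Require Import normal_distribution.
Set Implicit Arguments. Unset Strict Implicit. Unset Printing Implicit Defensive.
Import Order.TTheory GRing.Theory Num.Theory.

(* A (c,m)-colored B_n-partition: a set partition P of {0,...,n} (= 'I_n.+1)
   together with a colouring col.  col 0 = None (0 is not coloured);
   Some (inl i) = i-th colour of C1 (c colours), Some (inr j) = j-th colour
   of C2 (m colours); the "first colour of C2" is inr j with val j = 0. *)
Definition BnObj (n c m : nat) :=
  ({set {set 'I_n.+1}} * {ffun 'I_n.+1 -> option ('I_c + 'I_m)})%type.

Definition is_colored_Bpart (n c m : nat) (o : BnObj n c m) : bool :=
  let P := o.1 in let col := o.2 in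
  finset.partition P [set: 'I_n.+1] &&
  [forall x : 'I_n.+1,
     if val x == 0%N then col x == None
     else if [forall y in finset.pblock P x, (val x <= val y)%N] then
       (if col x is Some (inr j) then val j == 0%N else false)
     else if ord0 \in finset.pblock P x then
       (if col x is Some (inl _) then true else false)
     else
       (if col x is Some (inr _) then true else false)].

Definition colored_Bparts (n c m : nat) : {set BnObj n c m} :=
  [set o | is_colored_Bpart o].

Definition nonzero_blocks (n c m : nat) (o : BnObj n c m) : nat :=
  #|[set B in o.1 | ord0 \notin B]|.

Local Open Scope ring_scope.

Definition xi_mean (R : realType) (n c m : nat) : R :=
  (\sum_(o in colored_Bparts n c m) (nonzero_blocks o)%:R)
    / (#|colored_Bparts n c m|)%:R.

Definition xi_var (R : realType) (n c m : nat) : R :=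
  (\sum_(o in colored_Bparts n c m)
      ((nonzero_blocks o)%:R - xi_mean R n c m) ^+ 2)
    / (#|colored_Bparts n c m|)%:R.

Definition xi_normalized_cdf (R : realType) (n c m : nat) (x : R) : R :=
  (#|[set o in colored_Bparts n c m |
       ((nonzero_blocks o)%:R - xi_mean R n c m) / Num.sqrt (xi_var R n c m)
         <= x]|)%:R
    / (#|colored_Bparts n c m|)%:R.

(* Main.v *)
(* Adding the element n to a partition of {0,...,n-1} with k non-zero-blocks gives the recursion
   P_n = (X + c) P_(n-1) + m X P_(n-1)' for the generating polynomials of the number of
   non-zero-blocks.  Their roots are real and nonpositive (if P_(n-1) has this property and z is
   not real, then z P'(z)/P(z), a sum of terms z/(z+a), lies in the closed half plane of z, so
   P_n(z) <> 0), hence xi_n is distributed as a sum of independent Bernoulli variables, for which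
   Stein's method applies as soon as V_n -> oo.
   For the variance, xi_n plus an independent Poisson(1/m) variable has weights proportional to
   (c+mj)^n / (m^j j!) at j: these weights are so flat near their bulk that a shift by any fixed s
   hardly changes them, which forces the variance to be of order at least s^2.
   Stein's equation f' - x f = h is only solved for h = psi o Phi with psi supported away from 0
   and 1 and of integral 0; f = (Psi o Phi)/phi with Psi' = psi then has compact support and a
   Lipschitz derivative.  Such psi show that a |-> P(Phi(W) > a) is asymptotically affine, and
   Chebyshev's inequality fixes its boundary values, so that Phi(W) is asymptotically uniform. *)
Require Import Defs.
From HB Require Import structures.
From mathcomp Require Import all_boot all_order all_algebra.
From mathcomp Require Import zify ring lra.
From mathcomp Require Import all_classical all_reals all_analysis.
From mathcomp Require Import normal_distribution.
From mathcomp Require complex.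
Set Implicit Arguments. Unset Strict Implicit. Unset Printing Implicit Defensive.
Import Order.TTheory GRing.Theory Num.Theory.

(** * Words encoding coloured partitions *)

(** Entry [x] of a word holds the minimum of the block of [x] and the colour of [x]; this determines
    both the partition and the colouring. *)
Local Notation word c m := (seq (nat * option ('I_c + 'I_m))).

(** A block minimum is an entry that points to itself; the condition [0 < y] discards the
    zero-block. *)
Definition block_mins (c m : nat) (s : word c m) : seq nat :=
  [seq y <- iota 0 (size s) | (0 < y) && ((nth (0, None) s y).1 == y)].

(** The three ways to add one element: open a block (the colour is then forced), join the zero-block
    with a colour of C1, or join a non-zero-block with a colour of C2. *)
Definition extensions (c m : nat) (hm : 0 < m) (s : word c m) : word c m :=
  (size s, Some (inr (Ordinal hm))) ::
  [seq (0, Some (inl i)) | i <- enum 'I_c] ++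
  [seq (y, Some (inr j)) | y <- block_mins s, j <- enum 'I_m].

Arguments extensions : simpl never.

Fixpoint words (c m : nat) (hm : 0 < m) (n : nat) : seq (word c m) :=
  if n is n'.+1 then
    [seq rcons s v | s <- words c hm n', v <- extensions hm s]
  else [:: [:: (0, None)]].

Lemma mem_wordsS c m (hm : 0 < m) n s :
  reflect (exists t v, [/\ t \in words c hm n, v \in extensions hm t & s = rcons t v])
    (s \in words c hm n.+1).
Proof.
apply: (iffP flatten_mapP) => [[t tn /mapP[v vt ->]]|[t [v [tn vt ->]]]].
  by exists t, v.
by exists t => //; apply: map_f.
Qed.

Lemma size_words c m (hm : 0 < m) n s : s \in words c hm n -> size s = n.+1.
Proof.
elim: n s => [|n IH] s; first by rewrite inE => /eqP ->.
by move=> /mem_wordsS[t [v [/IH st _ ->]]]; rewrite size_rcons st.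
Qed.

Lemma block_mins_rcons c m (s : word c m) v : 0 < size s ->
  block_mins (rcons s v) =
    if v.1 == size s then rcons (block_mins s) (size s) else block_mins s.
Proof.
move=> s0; rewrite /block_mins size_rcons -[(size s).+1]addn1 iotaD filter_cat add0n /=.
rewrite nth_rcons ltnn eqxx s0 /=.
have -> : [seq y <- iota 0 (size s) |
     (0 < y) && ((nth (0, None) (rcons s v) y).1 == y)] = block_mins s.
  apply: eq_in_filter => y; rewrite mem_iota add0n => /andP[_ ys].
  by rewrite nth_rcons ys.
by case: ifP => _; rewrite ?cats1 ?cats0.
Qed.

Lemma mem_block_mins c m (s : word c m) y :
  (y \in block_mins s) =
    [&& 0 < y, y < size s & (nth (0, None) s y).1 == y].
Proof. by rewrite mem_filter mem_iota add0n /= andbAC andbA. Qed.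

Lemma extensionsP c m (hm : 0 < m) (s : word c m) v :
  reflect [\/ v = (size s, Some (inr (Ordinal hm))),
              exists i, v = (0, Some (inl i)) |
              exists2 y, y \in block_mins s & exists j, v = (y, Some (inr j))]
    (v \in extensions hm s).
Proof.
rewrite inE mem_cat; apply: (iffP or3P) => -[].
- by move/eqP; constructor 1.
- by case/mapP => i _ ->; constructor 2; exists i.
- case/allpairsP => -[y j] /= [ys _ ->]; constructor 3.
  by exists y => //; exists j.
- by move=> ->; constructor 1.
- by case=> i ->; constructor 2; apply/mapP; exists i; rewrite // mem_enum.
- case=> y ys [j ->]; constructor 3; apply/allpairsP.
  by exists (y, j); rewrite /= mem_enum.
Qed.

Lemma uniq_extensions c m (hm : 0 < m) (s : word c m) :
  0 < size s -> uniq (extensions hm s).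
Proof.
move=> s0; rewrite /extensions cons_uniq cat_uniq mem_cat negb_or.
apply/and3P; split.
- apply/andP; split; first by apply/mapP => -[i _] [].
  by apply/allpairsP => -[[y j]] /= [ys _ [E]]; move: ys;
    rewrite mem_block_mins -E ltnn andbF.
- by rewrite map_inj_uniq ?enum_uniq // => i j [].
apply/andP; split.
  by apply/hasPn => _ /allpairsP[[y j] [_ _ ->]]; apply/mapP => -[i _] [].
apply: allpairs_uniq; first by rewrite filter_uniq ?iota_uniq.
  exact: enum_uniq.
by move=> [? ?] [? ?] _ _ /= [-> ->].
Qed.

Lemma uniq_words c m (hm : 0 < m) n : uniq (words c hm n).
Proof.
elim: n => [//|n IH].
apply: (@allpairs_uniq_dep _ (fun=> (nat * option ('I_c + 'I_m))%type : eqType)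
  _ (fun s v => rcons s v)) => //.
  by move=> s /size_words ss; apply: uniq_extensions; rewrite ss.
by move=> [s v] [t w] _ _ /= /rcons_inj [-> ->].
Qed.

(** Unfolds the recursion position by position, so that membership of an encoding can be checked one
    letter at a time against its own prefix. *)
Lemma mem_words c m (hm : 0 < m) n (s : word c m) :
  reflect (size s = n.+1 /\ forall i, i < n.+1 ->
             if i == 0 then nth (0, None) s 0 = (0, None)
             else nth (0, None) s i \in extensions hm (take i s))
    (s \in words c hm n).
Proof.
elim: n s => [|n IH] s.
  rewrite inE; apply: (iffP eqP) => [-> | []]; first by split=> // -[].
  by case: s => [//|v [|//]] _ /(_ 0 isT) /= ->.
apply: (iffP idP).
  move=> /mem_wordsS[t [v [/IH[st vt] vE ->]]]; rewrite size_rcons st.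
  split=> // i; rewrite ltnS leq_eqVlt => /predU1P[->|ilt].
    by rewrite /= nth_rcons st ltnn eqxx -cats1 -st take_size_cat.
  have := vt i ilt; case: eqP => [i0|_].
    by rewrite nth_rcons st.
  by rewrite nth_rcons st ilt -cats1 takel_cat // st ltnW.
case; case/lastP: s => [//|t v]; rewrite size_rcons => -[st] tv.
apply/mem_wordsS; exists t, v; split=> //.
  apply/IH; split=> // i ilt; have := tv i (ltnW ilt); case: eqP => _.
    by rewrite nth_rcons st.
  by rewrite nth_rcons st ilt -cats1 takel_cat // st ltnW.
by have := tv n.+1 (leqnn _); rewrite nth_rcons st ltnn eqxx -cats1 -st take_size_cat.
Qed.

Local Open Scope ring_scope.

(** Of the extensions of a word with k block minima, one raises k by 1 and the other c + m k leave
    it unchanged. *)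
Lemma sum_words (V : zmodType) c m (hm : (0 < m)%N) n (F : nat -> V) :
  \sum_(s <- words c hm n.+1) F (size (block_mins s)) =
  \sum_(s <- words c hm n)
     (F (size (block_mins s)).+1 +
      F (size (block_mins s)) *+ (c + m * size (block_mins s))).
Proof.
rewrite [words _ _ _]/= big_flatten big_map big_seq [RHS]big_seq.
apply: eq_bigr => s /size_words ss.
have s0 : (0 < size s)%N by rewrite ss.
rewrite big_cons big_map big_cat /= block_mins_rcons // eqxx size_rcons; congr (_ + _).
rewrite mulrnDr; congr (_ + _).
  rewrite big_map (eq_bigr (fun=> F (size (block_mins s)))); last first.
    by move=> i _; rewrite block_mins_rcons //= ss.
  by rewrite big_const_seq count_predT size_enum_ord -Monoid.iteropE.
rewrite big_flatten big_map big_seq.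
rewrite (eq_bigr (fun=> F (size (block_mins s)) *+ m)); last first.
  move=> y; rewrite mem_block_mins => /and3P[_ ys _]; rewrite big_map.
  rewrite (eq_bigr (fun=> F (size (block_mins s)))); last first.
    by move=> i _; rewrite block_mins_rcons //= ltn_eqF.
  by rewrite big_const_seq count_predT size_enum_ord -Monoid.iteropE.
rewrite -big_seq big_const_seq count_predT -Monoid.iteropE mulrnA.
by [].
Qed.

Local Close Scope ring_scope.

(** * Block minima and the bijection between coloured partitions and words *)

Definition block_min (n : nat) (P : {set {set 'I_n.+1}}) (x : 'I_n.+1) : 'I_n.+1 :=
  [arg min_(y < x | y \in finset.pblock P x) (y : nat)].

Lemma block_minP n (P : {set {set 'I_n.+1}}) x :
  finset.partition P [set: 'I_n.+1] ->
  block_min P x \in finset.pblock P x /\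
  (forall y, y \in finset.pblock P x -> block_min P x <= y).
Proof.
move=> /and3P[/eqP cP _ _]; rewrite /block_min.
by case: arg_minnP => [|z xz zmin]; first by rewrite mem_pblock cP finset.in_setT.
Qed.

Lemma block_min_eq n (P : {set {set 'I_n.+1}}) x y :
  finset.partition P [set: 'I_n.+1] ->
  (block_min P x == block_min P y) = (finset.pblock P x == finset.pblock P y).
Proof.
move=> partP; have [_ tP _] := and3P partP.
have [xx xmin] := block_minP x partP; have [yy ymin] := block_minP y partP.
apply/eqP/eqP => E.
  by rewrite -(same_pblock tP xx) -(same_pblock tP yy) E.
by apply/val_inj/eqP; rewrite /= eqn_leq xmin ?ymin ?E // -E.
Qed.

Lemma block_min_le n (P : {set {set 'I_n.+1}}) x :
  finset.partition P [set: 'I_n.+1] -> block_min P x <= x.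
Proof.
move=> partP; have [_ ->//] := block_minP x partP.
by have /and3P[/eqP cP _ _] := partP; rewrite mem_pblock cP finset.in_setT.
Qed.

Lemma pblock_block_min n (P : {set {set 'I_n.+1}}) x :
  finset.partition P [set: 'I_n.+1] -> finset.pblock P (block_min P x) = finset.pblock P x.
Proof.
move=> partP; have [xx _] := block_minP x partP.
by have [_ tP _] := and3P partP; exact: same_pblock.
Qed.

Lemma block_min_idem n (P : {set {set 'I_n.+1}}) x :
  finset.partition P [set: 'I_n.+1] -> block_min P (block_min P x) = block_min P x.
Proof. by move=> partP; apply/eqP; rewrite block_min_eq // pblock_block_min. Qed.

Definition encode n c m (o : BnObj n c m) : word c m :=
  [seq (block_min o.1 x : nat, o.2 x) | x <- enum 'I_n.+1].

Lemma size_encode n c m (o : BnObj n c m) : size (encode o) = n.+1.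
Proof. by rewrite size_map size_enum_ord. Qed.

Lemma nth_encode n c m (o : BnObj n c m) (x : 'I_n.+1) :
  nth (0, None) (encode o) x = (block_min o.1 x : nat, o.2 x).
Proof. by rewrite (nth_map x) ?size_enum_ord // nth_ord_enum. Qed.

(** Two points share a block exactly when their block minima agree, so the partition is recovered as
    the kernel of [block_min]. *)
Lemma encode_inj n c m :
  {in colored_Bparts n c m &, injective (@encode n c m)}.
Proof.
move=> [P1 f1] [P2 f2]; rewrite !inE => /andP[/= p1 _] /andP[/= p2 _] E.
have H x : block_min P1 x = block_min P2 x /\ f1 x = f2 x.
  have := congr1 (nth (0, None) ^~ x) E; rewrite /= !nth_encode /=.
  by case=> /val_inj.
congr pair; last by apply/ffunP => x; case: (H x).
rewrite -(preim_partition_pblock p1) -(preim_partition_pblock p2).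
apply: eq_imset => x; apply/finset.setP => y.
by rewrite !inE /= -!block_min_eq // (H x).1 (H y).1.
Qed.

(** [pblock] maps the positive fixed points of [block_min] bijectively onto the blocks avoiding 0;
    the inverse sends a block to its minimum. *)
Lemma nonzero_blocks_encode n c m (o : BnObj n c m) :
  o \in colored_Bparts n c m -> size (block_mins (encode o)) = nonzero_blocks o.
Proof.
rewrite inE => /andP[partP _]; have [/eqP cP tP nP] := and3P partP.
rewrite /nonzero_blocks /block_mins size_encode -val_enum_ord filter_map size_map.
pose A := [set x : 'I_n.+1 | (0 < x) && (block_min o.1 x == x)].
transitivity #|A|.
  rewrite cardE /enum_mem size_filter -enumT -size_filter; congr size.
  rewrite -filter_predI; apply: eq_filter => x; rewrite !inE /= nth_encode andbT /=.
  by rewrite -val_eqE.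
have inj : {in A &, injective (finset.pblock o.1)}.
  move=> x y; rewrite !inE => /andP[_ /eqP xx] /andP[_ /eqP yy] E.
  by rewrite -xx -yy; apply/eqP; rewrite block_min_eq ?E.
rewrite -(card_in_imset inj); congr #|pred_of_set _|; apply/finset.setP => B.
rewrite inE; apply/imsetP/andP => [[x]|[BP B0]].
  rewrite inE => /andP[x0 /eqP xx] ->; split.
    by rewrite pblock_mem // cP finset.in_setT.
  apply/negP => x0B; have [_ xmin] := block_minP x partP.
  by have := xmin _ x0B; rewrite xx leqNgt x0.
have [x xB] : exists x, x \in B.
  by apply/set0Pn; apply: contraNneq nP => <-.
have EB := def_pblock tP BP xB.
exists (block_min o.1 x); last by rewrite pblock_block_min.
rewrite inE block_min_idem // eqxx andbT lt0n.
apply: contraNneq B0 => m0; rewrite -EB.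
have [xx _] := block_minP x partP; suff -> : ord0 = block_min o.1 x by [].
exact: val_inj.
Qed.

(** The three colouring rules for a positive element correspond one by one to the three cases of
    [extensionsP]. *)
Lemma encode_words n c m (hm : 0 < m) (o : BnObj n c m) :
  o \in colored_Bparts n c m -> encode o \in words c hm n.
Proof.
rewrite inE => /andP[partP /forallP colP]; have [/eqP cP tP nP] := and3P partP.
apply/mem_words; rewrite size_encode; split=> // i ilt.
have self (x : 'I_n.+1) : x \in finset.pblock o.1 x.
  by rewrite mem_pblock cP finset.in_setT.
have := colP (Ordinal ilt); set x := Ordinal ilt; rewrite -[i]/(val x) /= -/x.
case: eqP => [i0|i0] colx.
  have x0 : x = ord0 by apply: val_inj.
  rewrite -[X in nth _ _ X]/(val (ord0 : 'I_n.+1)) nth_encode -x0 (eqP colx).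
  congr pair; apply/eqP; rewrite -leqn0 -[X in _ <= X]i0.
  exact: (block_min_le x partP).
have sizet : size (take i (encode o)) = i by rewrite size_takel ?size_encode // ltnW.
rewrite -[X in nth _ _ X]/(val x) nth_encode.
have [xx xmin] := block_minP x partP.
apply/extensionsP; rewrite sizet; move: colx; case: ifP => [/forall_inP xm|notmin].
  case E: (o.2 x) => [[//|j]|//] /eqP j0; constructor 1.
  congr (_, Some (inr _)); last exact: val_inj.
  by apply/eqP; rewrite eqn_leq (block_min_le x) //=; apply: xm.
case: ifP => x0.
  case E: (o.2 x) => [[j|//]|//] _; constructor 2; exists j; congr pair.
  by apply/eqP; rewrite -leqn0; apply: (xmin _ x0).
case E: (o.2 x) => [[//|j]|//] _; constructor 3; exists (block_min o.1 x : nat); last by exists j.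
have bx : block_min o.1 x < i.
  rewrite ltn_neqAle (block_min_le x partP) andbT.
  apply: contraFneq notmin => Eb; apply/forall_inP => y /xmin.
  by rewrite -[X in X <= _ -> _]/(val (block_min o.1 x)) /= Eb.
rewrite mem_block_mins sizet bx nth_take // nth_encode block_min_idem // eqxx !andbT.
rewrite lt0n; apply: contraFneq x0 => b0.
by suff -> : ord0 = block_min o.1 x by []; exact: val_inj.
Qed.

(** These two properties make [b] the block-minimum map of its own kernel, which is what
    surjectivity of [encode] rests on. *)
Lemma words_min n c m (hm : 0 < m) (s : word c m) (b := fun i => (nth (0, None) s i).1) i :
  s \in words c hm n -> i < n.+1 -> b i <= i /\ b (b i) = b i.
Proof.
move=> /mem_words[ss sP] ilt.
have := sP i ilt; case: eqP => [->|/eqP i0]; first by move=> E; rewrite /b E /= E.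
have b0 : b 0 = 0 by rewrite /b; have /= -> := sP 0 isT.
have sizet : size (take i s) = i by rewrite size_takel ?ss // ltnW.
case/extensionsP => [||[y]]; rewrite ?sizet.
- by move=> E; have bi : b i = i; [rewrite /b E|rewrite !bi].
- by case=> j E; have bi : b i = 0; [rewrite /b E|rewrite bi b0].
rewrite mem_block_mins sizet => /and3P[y0 yi]; rewrite nth_take // => /eqP by_ [j E].
have bi : b i = y by rewrite /b E.
by rewrite bi (ltnW yi).
Qed.

(** The preimage is the kernel partition of the first components, coloured by the second
    components. *)
Lemma encode_onto n c m (hm : 0 < m) (s : word c m) :
  s \in words c hm n -> exists2 o, o \in colored_Bparts n c m & encode o = s.
Proof.
move=> sw; have [ss sP] := mem_words _ _ _ sw.
pose b (x : 'I_n.+1) := (nth (0, None) s x).1.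
have bx (x : 'I_n.+1) : b x <= x by case: (words_min sw (ltn_ord x)).
have blt (x : 'I_n.+1) : b x < n.+1 by apply: leq_ltn_trans (bx x) _.
pose B x := Ordinal (blt x).
have bb x : b (B x) = b x by case: (words_min sw (ltn_ord x)).
pose P := preim_partition b [set: 'I_n.+1].
have partP : finset.partition P [set: 'I_n.+1] by exact: preim_partitionP.
have pbP x y : (y \in finset.pblock P x) = (b x == b y).
  by rewrite pblock_equivalence_partition ?finset.in_setT //; split=> // /eqP->.
have bmE x : block_min P x = B x.
  have [] := block_minP x partP; rewrite pbP => /eqP Ex xmin.
  apply/val_inj/eqP; rewrite /= eqn_leq {2}Ex bx andbT.
  by apply: (xmin (B x)); rewrite pbP bb.
pose o : BnObj n c m := (P, [ffun x : 'I_n.+1 => (nth (0, None) s x).2]).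
exists o; last first.
  apply: (@eq_from_nth _ (0, None)); first by rewrite size_encode ss.
  rewrite size_encode => i ilt; rewrite -[i]/(val (Ordinal ilt)) nth_encode.
  by rewrite /= bmE ffunE /= /b /= -surjective_pairing.
rewrite inE; apply/andP; split=> //; apply/forallP => x; rewrite ffunE /=.
have := sP x (ltn_ord x); case: eqP => [->->//|/eqP x0].
have sizet : size (take x s) = x by rewrite size_takel ?ss // ltnW.
case/extensionsP => [|[j]|[y ys [j]]] E.
- rewrite E /=.
  have bxE : b x = x by rewrite /b E sizet.
  case: ifP => [//|/negP[]]; apply/forall_inP => y; rewrite pbP bxE => /eqP ->.
  exact: bx.
- have bxE : b x = 0 by rewrite /b E.
  have b0 : ord0 \in finset.pblock P x.
    by rewrite pbP bxE eq_sym -leqn0; apply: (bx ord0).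
  rewrite E /= b0; case: ifP => // /forall_inP /(_ _ b0).
  by rewrite leqNgt lt0n x0.
- have bxE : b x = y by rewrite /b E.
  move: ys; rewrite mem_block_mins sizet => /and3P[y0 yx _].
  (* [x] is not minimal, since [B x], of value [y < x], lies in its block; and 0 is not in that
     block because [b] is positive there. *)
  rewrite E /= ifN; last first.
    apply/negP => /forall_inP /(_ (B x)); rewrite pbP bb eqxx => /(_ isT) /=.
    by rewrite bxE leqNgt yx.
  rewrite ifN // pbP bxE; apply: contraTneq y0 => ->.
  by rewrite -leqNgt; apply: (bx ord0).
Qed.

Local Open Scope ring_scope.

Lemma sum_colored_Bparts (V : zmodType) n c m (hm : (0 < m)%N) (F : nat -> V) :
  \sum_(o in colored_Bparts n c m) F (nonzero_blocks o) =
  \sum_(s <- words c hm n) F (size (block_mins s)).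
Proof.
rewrite -big_enum /=.
rewrite (eq_big_seq (fun o => F (size (block_mins (encode o))))); last first.
  by move=> o; rewrite mem_enum => /nonzero_blocks_encode ->.
rewrite -(big_map (@encode n c m) xpredT (fun s => F (size (block_mins s)))).
apply: perm_big; apply: uniq_perm.
- rewrite map_inj_in_uniq ?enum_uniq // => x y; rewrite !mem_enum.
  exact: encode_inj.
- exact: uniq_words.
move=> s; apply/mapP/idP => [[x]|/encode_onto[x xC <-]].
  by rewrite mem_enum => xC ->; exact: encode_words.
by exists x; rewrite ?mem_enum.
Qed.

(** * The generating polynomials are real-rooted *)

(** The sum over k of S(n,k) g(k), where S(n,k) counts the objects with k non-zero-blocks. The
    recursion acts on the test function [g], so the numbers S(n,k) never have to be named. *)
Fixpoint stirling_sum (R : pzRingType) (c m n : nat) (g : nat -> R) : R :=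
  if n is n'.+1 then
    stirling_sum c m n' (fun k => g k.+1 + (c + m * k)%:R * g k)
  else g 0%N.

(** The linear functional on polynomials that sends X^k to g(k). *)
Definition coef_pairing (R : pzRingType) (p : seq R) (g : nat -> R) : R :=
  \sum_(i < size p) p`_i * g i.

Fixpoint stirling_poly (R : nzRingType) (c m n : nat) : {poly R} :=
  if n is n'.+1 then
    let p := stirling_poly R c m n' in ('X + c%:R%:P) * p + m%:R *: ('X * p^`())
  else 1.

Lemma coef_pairing_widen (R : nzRingType) (p : {poly R}) (g : nat -> R) N :
  (size p <= N)%N -> coef_pairing p g = \sum_(i < N) p`_i * g i.
Proof.
move=> pN; rewrite /coef_pairing (big_ord_widen N (fun i => p`_i * g i)) //.
rewrite big_mkcond; apply: eq_bigr => i _; case: ltnP => // /leq_sizeP -> //.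
by rewrite mul0r.
Qed.

Lemma coef_pairingD (R : nzRingType) (p q : {poly R}) (g : nat -> R) :
  coef_pairing (p + q) g = coef_pairing p g + coef_pairing q g.
Proof.
pose N := maxn (size p) (size q).
rewrite !(@coef_pairing_widen _ _ _ N) ?leq_maxl ?leq_maxr ?size_polyD //.
by rewrite -big_split; apply: eq_bigr => i _; rewrite coefD mulrDl.
Qed.

Lemma coef_pairingZ (R : nzRingType) a (p : {poly R}) (g : nat -> R) :
  coef_pairing (a *: p) g = a * coef_pairing p g.
Proof.
rewrite (@coef_pairing_widen _ _ _ (size p)) ?size_scale_leq // mulr_sumr.
by apply: eq_bigr => i _; rewrite coefZ mulrA.
Qed.

Lemma coef_pairingX (R : nzRingType) (p : {poly R}) (g : nat -> R) :
  coef_pairing ('X * p) g = coef_pairing p (fun k => g k.+1).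
Proof.
rewrite (@coef_pairing_widen _ _ _ (size p).+1); last first.
  by rewrite (leq_trans (size_polyMleq _ _)) // size_polyX.
rewrite big_ord_recl coefXM mul0r add0r; apply: eq_bigr => i _.
by rewrite coefXM.
Qed.

Lemma coef_pairing_deriv (R : nzRingType) (p : {poly R}) (g : nat -> R) :
  coef_pairing ('X * p^`()) g = coef_pairing p (fun k => k%:R * g k).
Proof.
have sp : (size p^`() <= size p)%N.
  by apply/leq_sizeP => i ip; rewrite coef_deriv nth_default ?mul0rn // leqW.
rewrite coef_pairingX (@coef_pairing_widen _ _ _ (size p)) //.
rewrite [RHS](@coef_pairing_widen _ _ _ (size p).+1) //.
rewrite big_ord_recl /= mul0r mulr0 add0r; apply: eq_bigr => i _.
by rewrite coef_deriv mulrA mulr_natr.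
Qed.

Lemma coef_pairing_ext (R : nzRingType) (p : {poly R}) (g h : nat -> R) :
  g =1 h -> coef_pairing p g = coef_pairing p h.
Proof. by move=> gh; apply: eq_bigr => i _; rewrite gh. Qed.

Lemma coef_pairing_addr (R : nzRingType) (p : {poly R}) (g h : nat -> R) :
  coef_pairing p (fun k => g k + h k) = coef_pairing p g + coef_pairing p h.
Proof. by rewrite -big_split; apply: eq_bigr => i _; rewrite mulrDr. Qed.

Lemma coef_pairing_scaler (R : comNzRingType) a (p : {poly R}) (g : nat -> R) :
  coef_pairing p (fun k => a * g k) = a * coef_pairing p g.
Proof. by rewrite mulr_sumr; apply: eq_bigr => i _; rewrite mulrCA. Qed.

(** Under the pairing, multiplication by X is dual to the shift of [g], and X d/dX is dual to
    multiplication of g(k) by k; the two recursions are thus transposes of each other. *)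
Lemma stirling_sum_poly (R : comNzRingType) c m n (g : nat -> R) :
  stirling_sum c m n g = coef_pairing (stirling_poly R c m n) g.
Proof.
elim: n g => [|n IH] g /=.
  by rewrite /coef_pairing size_poly1 big_ord1 coef1 mul1r.
rewrite IH mulrDl !coef_pairingD coef_pairingX coef_pairingZ coef_pairing_deriv.
rewrite mul_polyC coef_pairingZ -!coef_pairing_scaler -!coef_pairing_addr.
by apply: coef_pairing_ext => k; rewrite natrD natrM; ring.
Qed.

Definition neg_root_poly (R : nzRingType) (s : seq R) : {poly R} :=
  \prod_(a <- s) ('X + a%:P).

Section Complex.
Import complex.
Local Open Scope complex_scope.

Lemma complex_neq0 (R : rcfType) (z : R[i]) : Im z != 0 -> z != 0.
Proof. by apply: contraNneq => ->. Qed.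

(* [z P'(z) / P(z)] is the sum of the [z / (z + a)], each of which lies in the same
   half plane as [z]. *)
Lemma logderiv_im (R : rcfType) (s : seq R) (x y : R) :
  {in s, forall a, 0 <= a} -> y != 0 ->
  let z : R[i] := x +i* y in
  let P := map_poly (real_complex R) (neg_root_poly s) in
  P.[z] != 0 /\ exists2 w, z * P^`().[z] = w * P.[z] & 0 <= y * Im w.
Proof.
move=> s0 y0 z P; rewrite {}/P; elim: s s0 => [|a s IH] s0.
  rewrite /neg_root_poly big_nil rmorph1 hornerC oner_neq0; split=> //.
  by exists 0; rewrite ?mulr0 // -polyC1 derivC hornerC mulr0 mul0r.
rewrite /neg_root_poly big_cons -/(neg_root_poly s) rmorphM rmorphD /=.
rewrite map_polyX map_polyC /=.
have [|P0 [w Ew wy]] := IH; first by move=> b bs; apply: s0; rewrite inE bs orbT.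
set P := map_poly _ _ in P0 Ew *.
have a0 : 0 <= a by apply: s0; rewrite mem_head.
have za : z + a%:C != 0 by apply: complex_neq0; rewrite /= addr0.
rewrite hornerM hornerD hornerX hornerC mulf_neq0 //; split=> //.
have d0 : 0 < (x + a) ^+ 2 + y ^+ 2.
  by rewrite ltr_wpDl ?sqr_ge0 // exprn_even_gt0.
(* [t] is z / (z + a), split into real and imaginary part by multiplying with the conjugate of z +
   a. *)
pose t : R[i] := ((x * (x + a) + y ^+ 2) / ((x + a) ^+ 2 + y ^+ 2)) +i*
                 (a * y / ((x + a) ^+ 2 + y ^+ 2)).
have tE : t * (z + a%:C) = z.
  by rewrite /t /z; simpc; congr (_ +i* _); field; rewrite gt_eqF.
exists (t + w); last first.
  case: w wy {Ew} => w1 w2 /= wy; rewrite mulrDr addr_ge0 //.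
  rewrite (_ : _ * _ = a * y ^+ 2 / ((x + a) ^+ 2 + y ^+ 2)); last by ring.
  apply: divr_ge0; [by rewrite mulr_ge0 ?sqr_ge0|exact: ltW].
rewrite derivM derivD derivX derivC addr0 mul1r hornerD hornerM hornerD hornerX hornerC.
transitivity (t * (z + a%:C) * P.[z] + (z + a%:C) * (z * P^`().[z])).
  by rewrite tE; ring.
by rewrite Ew; ring.
Qed.

(** At a non-real z, with z P'(z) = w P(z), the new polynomial equals (z + c + m w) P(z). The
    imaginary part of the first factor has the strict sign of Im z, so neither factor vanishes.
    Positivity on the positive axis excludes positive roots. *)
Lemma real_rooted_step (R : rcfType) (s : seq R) (l c m : R) :
  {in s, forall a, 0 <= a} -> 0 < l -> 0 <= c -> 0 <= m ->
  let P := l *: neg_root_poly s in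
  exists s' l', [/\ {in s', forall a, 0 <= a}, 0 < l' &
    ('X + c%:P) * P + m *: ('X * P^`()) = l' *: neg_root_poly s'].
Proof.
move=> s0 l0 c0 m0 P; set Q := _ + _.
have pos (t : seq R) x : {in t, forall a, 0 <= a} -> 0 < x -> 0 < (neg_root_poly t).[x].
  move=> t0 x0; rewrite /neg_root_poly horner_prod big_seq prodr_gt0 //.
  by move=> a /t0 a0; rewrite hornerD hornerX hornerC ltr_wpDr.
have dpos (t : seq R) x : {in t, forall a, 0 <= a} -> 0 < x ->
    0 <= (neg_root_poly t)^`().[x].
  move=> + x0; elim: t => [|a t IH] t0.
    by rewrite /neg_root_poly big_nil -polyC1 derivC hornerC.
  rewrite /neg_root_poly big_cons -/(neg_root_poly t) derivM derivD derivX derivC.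
  rewrite addr0 mul1r hornerD hornerM hornerD hornerX hornerC.
  have t0' : {in t, forall a, 0 <= a} by move=> b bt; apply: t0; rewrite inE bt orbT.
  have a0 : 0 <= a by apply: t0; rewrite mem_head.
  by rewrite addr_ge0 ?mulr_ge0 ?IH // ?addr_ge0 // ltW // pos.
have Qpos x : 0 < x -> 0 < Q.[x].
  move=> x0; rewrite /Q /P derivZ !hornerE ltr_wpDr //.
    by rewrite !mulr_ge0 ?dpos // ltW.
  by rewrite !mulr_gt0 ?pos // ltr_wpDr.
pose QC := map_poly (real_complex R) Q.
have [r Er] := closed_field_poly_normal QC.
have QC0 : QC != 0.
  rewrite map_poly_eq0; apply/eqP => Q0.
  by have := Qpos 1 ltr01; rewrite Q0 horner0 ltxx.
have rreal z : z \in r -> Im z = 0.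
  move=> zr; apply/eqP; apply/negPn/negP => Imz.
  have : QC.[z] == 0.
    rewrite Er hornerZ mulf_eq0; apply/orP; right.
    by rewrite -[_ == 0]/(root _ z) root_prod_XsubC.
  case: z zr Imz => x y _ /= y0.
  have [P0 [w Ew wy]] := @logderiv_im _ s x y s0 y0.
  set PC := map_poly _ _ in P0 Ew; set z := (x +i* y) in P0 Ew *.
  have -> : QC.[z] = (z + c%:C + m%:C * w) * (l%:C * PC.[z]).
    rewrite /QC /Q /P derivZ rmorphD rmorphM rmorphD /= map_polyX map_polyC /=.
    rewrite !map_polyZ rmorphM /= map_polyX map_polyZ -deriv_map -/PC.
    rewrite !(hornerD, hornerM, hornerZ, hornerX, hornerC).
    transitivity ((z + c%:C) * (l%:C * PC.[z]) + m%:C * l%:C * (z * PC^`().[z])).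
      by ring.
    by rewrite Ew; ring.
  rewrite mulf_eq0 mulf_eq0 (negPf P0) orbF orbC.
  rewrite (_ : l%:C == 0 = false) /=; last first.
    by apply/eqP => -[] /eqP; rewrite gt_eqF.
  apply/negP.
  apply: complex_neq0; case: w wy {Ew} => w1 w2 /= wy.
  have : 0 < y * (y + 0 + (m * w2 + 0 * w1)).
    rewrite addr0 mul0r addr0 mulrDr ltr_pwDl //.
      by rewrite -expr2 exprn_even_gt0.
    by rewrite mulrCA mulr_ge0.
  by apply: contraTneq => ->; rewrite mulr0 ltxx.
have [r' rE] : exists r', r = [seq real_complex R x | x <- r'].
  exists [seq Re z | z <- r]; rewrite -map_comp -[LHS]map_id; apply/eq_in_map => z /rreal.
  by case: z => a b /= ->.
(* All complex roots being real, the factorization over the complex numbers descends to the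
   reals. *)
have QE : Q = lead_coef Q *: \prod_(x <- r') ('X - x%:P).
  apply: (@map_poly_inj _ _ (real_complex R)); rewrite -/QC Er map_polyZ.
  rewrite lead_coef_map; congr (_ *: _).
  rewrite rmorph_prod rE big_map /=; apply: eq_bigr => x _.
  by rewrite rmorphB /= map_polyX map_polyC.
exists [seq - x | x <- r'], (lead_coef Q).
have QE' : Q = lead_coef Q *: neg_root_poly [seq - x | x <- r'].
  rewrite [LHS]QE /neg_root_poly big_map; congr (_ *: _).
  by apply: eq_bigr => x _; rewrite polyCN.
have s'0 : {in [seq - x | x <- r'], forall a, 0 <= a}.
  move=> _ /mapP[x xr ->]; rewrite oppr_ge0 leNgt; apply/negP => /Qpos.
  rewrite QE hornerZ (_ : (\prod_(x <- r') _).[x] = 0) ?mulr0 ?ltxx //.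
  by apply/eqP; rewrite -[_ == 0]/(root _ x) root_prod_XsubC.
(* Evaluation at 1, where both Q and the product are positive, gives the sign of the leading
   coefficient. *)
split=> //; have := Qpos 1 ltr01; rewrite {1}QE' hornerZ.
by rewrite pmulr_lgt0 ?pos.
Qed.

End Complex.

Lemma stirling_poly_real_rooted (R : rcfType) c m n :
  exists s (l : R), [/\ {in s, forall a, 0 <= a}, 0 < l &
    stirling_poly R c m n = l *: neg_root_poly s].
Proof.
elim: n => [|n [s [l [s0 l0 E]]]].
  by exists [::], 1; split; rewrite // /neg_root_poly big_nil scale1r.
rewrite /= E; exact: real_rooted_step.
Qed.

(** The expectation of [g] at a sum of independent Bernoulli variables with success probabilities
    [s], computed by averaging over one variable at a time. *)
Fixpoint bernoulli_sum (R : pzRingType) (s : seq R) (g : nat -> R) : R :=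
  if s is p :: s' then
    bernoulli_sum s' (fun k => p * g k.+1 + (1 - p) * g k)
  else g 0%N.

(** X + a = (1 + a) (p X + 1 - p) with p = 1 / (1 + a): each factor is, up to a constant, the
    generating polynomial of a Bernoulli variable. *)
Lemma coef_pairing_bernoulli (R : realFieldType) (s : seq R) (g : nat -> R) :
  {in s, forall a, 0 <= a} ->
  coef_pairing (neg_root_poly s) g =
  (\prod_(a <- s) (1 + a)) * bernoulli_sum [seq (1 + a)^-1 | a <- s] g.
Proof.
elim: s g => [|a s IH] g s0.
  rewrite /neg_root_poly !big_nil /= /coef_pairing size_poly1 big_ord1 coef1.
  by rewrite !mul1r.
have a0 : 0 <= a by apply: s0; rewrite mem_head.
rewrite /neg_root_poly !big_cons -/(neg_root_poly s) mulrDl coef_pairingD.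
rewrite coef_pairingX mul_polyC coef_pairingZ -coef_pairing_scaler.
rewrite -coef_pairing_addr /= -mulrA -IH; last first.
  by move=> b bs; apply: s0; rewrite inE bs orbT.
rewrite -coef_pairing_scaler; apply: coef_pairing_ext => k; field.
by rewrite gt_eqF // ltr_wpDr.
Qed.

(** The choice g = 1 identifies the normalizing constant as the total number of objects. *)
Lemma stirling_sum_bernoulli (R : rcfType) c m n :
  exists s : seq R, {in s, forall p, 0 <= p <= 1} /\
  forall g, stirling_sum c m n g = stirling_sum c m n (fun=> 1) * bernoulli_sum s g.
Proof.
have [s [l [s0 l0 E]]] := stirling_poly_real_rooted R c m n.
exists [seq (1 + a)^-1 | a <- s]; split.
  move=> _ /mapP[a /s0 a0 ->]; rewrite invr_ge0 addr_ge0 //=.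
  by rewrite invf_le1 ?lerDl // ltr_wpDr.
have one (t : seq R) : bernoulli_sum t (fun=> 1) = 1.
  elim: t => //= p t IH; rewrite -[RHS]IH; congr bernoulli_sum.
  by apply/funext => k; ring.
move=> g; rewrite !stirling_sum_poly E !coef_pairingZ !coef_pairing_bernoulli //.
by rewrite one mulr1 mulrA.
Qed.

(** * Stein's identity for sums of independent Bernoulli variables *)

Lemma bernoulli_sum_ext (R : pzRingType) (s : seq R) (g h : nat -> R) :
  g =1 h -> bernoulli_sum s g = bernoulli_sum s h.
Proof. by move=> /funext ->. Qed.

Lemma bernoulli_sumD (R : comPzRingType) (s : seq R) (g h : nat -> R) :
  bernoulli_sum s (fun k => g k + h k) = bernoulli_sum s g + bernoulli_sum s h.
Proof.
elim: s g h => //= p s IH g h; rewrite -IH.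
by apply: bernoulli_sum_ext => k; ring.
Qed.

Lemma bernoulli_sumZ (R : comPzRingType) (s : seq R) a (g : nat -> R) :
  bernoulli_sum s (fun k => a * g k) = a * bernoulli_sum s g.
Proof.
elim: s g => //= p s IH g; rewrite -IH.
by apply: bernoulli_sum_ext => k; ring.
Qed.

Lemma bernoulli_sumB (R : comPzRingType) (s : seq R) (g h : nat -> R) :
  bernoulli_sum s (fun k => g k - h k) = bernoulli_sum s g - bernoulli_sum s h.
Proof.
rewrite -mulN1r -bernoulli_sumZ -bernoulli_sumD.
by apply: bernoulli_sum_ext => k; rewrite mulN1r.
Qed.

Lemma bernoulli_sum_cst (R : comPzRingType) (s : seq R) (a : R) :
  bernoulli_sum s (fun=> a) = a.
Proof.
elim: s => //= p s IH; rewrite -[RHS]IH.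
by apply: bernoulli_sum_ext => k; ring.
Qed.

Lemma ler_bernoulli_sum (R : realDomainType) (s : seq R) (g h : nat -> R) :
  {in s, forall p, 0 <= p <= 1} -> (forall k, g k <= h k) ->
  bernoulli_sum s g <= bernoulli_sum s h.
Proof.
elim: s g h => //= p s IH g h s01 gh.
have /andP[p0 p1] : 0 <= p <= 1 by apply: s01; rewrite mem_head.
apply: IH => [q qs|k]; first by apply: s01; rewrite inE qs orbT.
by rewrite lerD // ler_wpM2l // subr_ge0.
Qed.

Lemma bernoulli_sum_norm_le (R : realDomainType) (s : seq R) (g : nat -> R) (M : R) :
  {in s, forall p, 0 <= p <= 1} -> (forall k, `|g k| <= M) ->
  `|bernoulli_sum s g| <= M.
Proof.
move=> s01 gM; have gM' k : - M <= g k <= M by rewrite -ler_norml.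
rewrite ler_norml; apply/andP; split.
  rewrite -[leLHS](bernoulli_sum_cst s).
  by apply: ler_bernoulli_sum => // k; case/andP: (gM' k).
rewrite -[leRHS](bernoulli_sum_cst s).
by apply: ler_bernoulli_sum => // k; case/andP: (gM' k).
Qed.

(* Induction on the summands: one more Bernoulli variable replaces [g] by an average of [g]
   and its shift, and contributes exactly [p (1 - p)] times a mean of [g k.+1 - g k]. *)
Lemma stein_bernoulli (R : realDomainType) (s : seq R) (g : nat -> R) (M : R) :
  {in s, forall p, 0 <= p <= 1} -> (forall k, `|g k.+2 - g k.+1 *+ 2 + g k| <= M) ->
  let mu := \sum_(p <- s) p in let v := \sum_(p <- s) p * (1 - p) in
  `|bernoulli_sum s (fun k => (k%:R - mu) * g k)
      - v * bernoulli_sum s (fun k => g k.+1 - g k)| <= v * M.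
Proof.
elim: s g => [|p s IH] g s01 gM /=.
  by rewrite !big_nil subr0 !mul0r subrr normr0.
have /andP[p0 p1] : 0 <= p <= 1 by apply: s01; rewrite mem_head.
have s01' : {in s, forall p, 0 <= p <= 1}.
  by move=> q qs; apply: s01; rewrite inE qs orbT.
have M0 : 0 <= M by apply: le_trans (gM 0%N).
rewrite !big_cons; set mu := \sum_(j <- s) j; set v := \sum_(j <- s) _.
pose G k := p * g k.+1 + (1 - p) * g k.
have GM k : `|G k.+2 - G k.+1 *+ 2 + G k| <= M.
  rewrite (_ : _ + _ = p * (g k.+3 - g k.+2 *+ 2 + g k.+1) +
     (1 - p) * (g k.+2 - g k.+1 *+ 2 + g k)); last by rewrite /G; ring.
  rewrite (le_trans (ler_normD _ _)) // !normrM (ger0_norm p0).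
  rewrite (ger0_norm (_ : 0 <= 1 - p)) ?subr_ge0 //.
  have -> : M = p * M + (1 - p) * M by ring.
  by rewrite lerD // ler_wpM2l // subr_ge0.
have := IH G s01' GM; rewrite /= -/mu -/v.
set X := bernoulli_sum s _; set Y := bernoulli_sum s _ => XY.
pose Z := bernoulli_sum s (fun k => g k.+1 - g k).
have -> : bernoulli_sum s (fun k => p * ((k.+1%:R - (p + mu)) * g k.+1) +
     (1 - p) * ((k%:R - (p + mu)) * g k)) = X + p * (1 - p) * Z.
  rewrite -bernoulli_sumZ -bernoulli_sumD; apply: bernoulli_sum_ext => k.
  by rewrite /G -natr1; ring.
have -> : bernoulli_sum s (fun k => p * (g k.+2 - g k.+1) +
     (1 - p) * (g k.+1 - g k)) = Y.
  by apply: bernoulli_sum_ext => k; rewrite /G; ring.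
(* Z - Y is -p times a mean of second differences of [g]. *)
have ZY : `|Z - Y| <= M.
  rewrite -bernoulli_sumB bernoulli_sum_norm_le // => k.
  rewrite (_ : _ - _ = - p * (g k.+2 - g k.+1 *+ 2 + g k)); last by rewrite /G; ring.
  by rewrite normrM normrN (ger0_norm p0) -[M]mul1r ler_pM.
rewrite (_ : _ - _ = (X - v * Y) + p * (1 - p) * (Z - Y)); last by ring.
rewrite (le_trans (ler_normD _ _)) // mulrDl addrC lerD //.
have pq0 : 0 <= p * (1 - p) by rewrite mulr_ge0 // subr_ge0.
by rewrite normrM ger0_norm // ler_wpM2l.
Qed.

(** Stein's identity for g = 1, which is exact because the second differences vanish. *)
Lemma bernoulli_sum_mean (R : realDomainType) (s : seq R) :
  {in s, forall p, 0 <= p <= 1} ->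
  bernoulli_sum s (fun k => k%:R) = \sum_(p <- s) p.
Proof.
move=> s01; have gM (k : nat) : `|1 - 1 *+ 2 + 1 : R| <= 0.
  by rewrite (_ : _ + _ = 0) ?normr0 //; ring.
have := @stein_bernoulli R s (fun=> 1) 0 s01 gM; rewrite /= mulr0 normr_le0.
rewrite (bernoulli_sum_ext s (h := fun k => k%:R - \sum_(p <- s) p)); last first.
  by move=> k; rewrite mulr1.
rewrite bernoulli_sumB bernoulli_sum_cst (bernoulli_sum_ext s (h := fun=> 0)); last first.
  by move=> k; rewrite subrr.
by rewrite bernoulli_sum_cst mulr0 subr0 subr_eq0 => /eqP.
Qed.

(** Stein's identity for g(k) = k - mu, again exact since [g] is affine. *)
Lemma bernoulli_sum_var (R : realDomainType) (s : seq R) :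
  {in s, forall p, 0 <= p <= 1} ->
  bernoulli_sum s (fun k => (k%:R - \sum_(p <- s) p) ^+ 2) = \sum_(p <- s) p * (1 - p).
Proof.
move=> s01; set mu := \sum_(p <- s) p; set v := \sum_(p <- s) _.
have gM k : `|(k.+2%:R - mu) - (k.+1%:R - mu) *+ 2 + (k%:R - mu)| <= 0.
  by rewrite -!natr1 (_ : _ + _ = 0) ?normr0 //; ring.
have := @stein_bernoulli R s (fun k => k%:R - mu) 0 s01 gM; rewrite /= -/mu -/v.
have -> : bernoulli_sum s (fun k => k.+1%:R - mu - (k%:R - mu)) = 1.
  rewrite -[RHS](bernoulli_sum_cst s); apply: bernoulli_sum_ext => k.
  by rewrite -natr1; ring.
by rewrite mulr0 normr_le0 mulr1 subr_eq0 => /eqP.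
Qed.

(** * The variance tends to infinity *)

Lemma stirling_sumD (R : comPzRingType) c m n (g h : nat -> R) :
  stirling_sum c m n (fun k => g k + h k) = stirling_sum c m n g + stirling_sum c m n h.
Proof.
elim: n g h => //= n IH g h; rewrite -IH; congr stirling_sum.
by apply/funext => k; ring.
Qed.

Lemma stirling_sumZ (R : comPzRingType) c m n a (g : nat -> R) :
  stirling_sum c m n (fun k => a * g k) = a * stirling_sum c m n g.
Proof.
elim: n g => //= n IH g; rewrite -IH; congr stirling_sum.
by apply/funext => k; ring.
Qed.

Lemma stirling_sum_sum (R : comPzRingType) c m n N (F : nat -> nat -> R) :
  stirling_sum c m n (fun k => \sum_(0 <= j < N) F j k) =
  \sum_(0 <= j < N) stirling_sum c m n (F j).
Proof.
elim: N => [|N IH].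
  rewrite big_geq // (_ : (fun _ => _) = (fun k => 0 * 0)).
    by rewrite (stirling_sumZ _ _ _ 0 (fun=> 0)) mul0r.
  by apply/funext => k; rewrite big_geq // mul0r.
rewrite big_nat_recr //= -IH -stirling_sumD; congr stirling_sum.
by apply/funext => k; rewrite big_nat_recr.
Qed.

Lemma ler_stirling_sum (R : realDomainType) c m n (g h : nat -> R) :
  (forall k, (k <= n)%N -> g k <= h k) -> stirling_sum c m n g <= stirling_sum c m n h.
Proof.
elim: n g h => [|n IH] g h gh /=; first exact: gh.
by apply: IH => k kn; rewrite lerD ?ler_wpM2l ?gh // leqW.
Qed.

Lemma stirling_sum1_gt0 (R : realDomainType) c m n :
  (0 < c)%N -> 0 < stirling_sum c m n (fun=> 1 : R).
Proof.
move=> c0; suff H (a : R) : 1 <= a -> 1 <= stirling_sum c m n (fun=> a).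
  exact: lt_le_trans ltr01 (H 1 (lexx _)).
elim: n a => //= n IH a a1; apply: le_trans (IH _ a1) _.
apply: ler_stirling_sum => k _; rewrite lerDl mulr_ge0 //.
exact: le_trans a1.
Qed.

(* The number of maps from [n] to [c] colours and [j] boxes with [m] colours each. *)
Lemma stirling_sum_ffact (R : comNzRingType) c m n j :
  stirling_sum c m n (fun k => (m ^ k * j ^_ k)%:R) = ((c + m * j) ^ n)%:R :> R.
Proof.
elim: n => [|n IH] /=; first by rewrite expn0 mul1n ffactn0.
rewrite expnS natrM -IH -stirling_sumZ; congr stirling_sum.
apply/funext => k; rewrite -!natrM -natrD; congr (_%:R).
case: (leqP k j) => [kj|jk].
  rewrite ffactnSr expnS -{4}(subnK kj).
  by move: (j - k)%N (m ^ k)%N (j ^_ k)%N => d a b; ring.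
by rewrite !ffact_small // ?muln0 //; apply: ltnW.
Qed.

(** * Dobinski-type weights: moments, flatness and growth *)

Definition dobinski (R : unitRingType) c m n (j : nat) : R :=
  ((c + m * j) ^ n)%:R / (m ^ j * j`!)%:R.

Lemma dobinski_ge0 (R : realFieldType) c m n j : 0 <= dobinski R c m n j.
Proof. by rewrite divr_ge0. Qed.

(* Convolving the number of non-zero blocks with a (truncated) Poisson(1/m) law gives the
   explicit weights [dobinski]. *)
Lemma sum_dobinski (R : realFieldType) c m n N (g : nat -> R) : (0 < m)%N ->
  \sum_(0 <= j < N) dobinski R c m n j * g j =
  stirling_sum c m n (fun k => \sum_(0 <= i < N - k) g (i + k)%N / (m ^ i * i`!)%:R).
Proof.
move=> m0; transitivity (stirling_sum c m n (fun k =>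
    \sum_(0 <= j < N) (g j / (m ^ j * j`!)%:R) * (m ^ k * j ^_ k)%:R)).
  rewrite stirling_sum_sum; apply: eq_bigr => j _.
  by rewrite stirling_sumZ stirling_sum_ffact /dobinski; ring.
congr stirling_sum; apply/funext => k.
case: (leqP k N) => [kN|Nk]; last first.
  have -> : (N - k = 0)%N by lia.
  rewrite [RHS]big_geq // big1_seq // => j /=; rewrite mem_index_iota => /andP[_ jN].
  by rewrite ffact_small ?muln0 ?mulr0 //; lia.
(* Terms with j < k vanish; for j = i + k the falling factorial turns 1 / j! into 1 / i!. *)
rewrite (big_cat_nat (n := k)) //= [X in X + _]big1_seq ?add0r; last first.
  move=> j /=; rewrite mem_index_iota => /andP[_ jN].
  by rewrite ffact_small ?muln0 ?mulr0.
rewrite -{1}[k]add0n big_addn; apply: eq_bigr => i _.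
rewrite -mulrA; congr (_ * _).
have f := @ffact_fact (i + k) k (leq_addl _ _); rewrite addnK in f.
rewrite -f expnD !natrM; field.
by rewrite !pnatr_eq0 -!lt0n ?expn_gt0 ?m0 ?fact_gt0 ?ffact_gt0 ?leq_addl.
Qed.

(** Compares (i^2 + 1) / i! with the geometric sequence 16 / 2^i. The values up to 4 are computed,
    and the induction runs from there. *)
Lemma sqr_le_fact (i : nat) : (2 ^ i * (i ^ 2 + 1) <= 16 * i`!)%N.
Proof.
case: i => [//|[//|[//|[//|i]]]]; elim: i => [//|i IH].
rewrite factS expnS mulnCA.
have H : (2 * ((i.+4.+1) ^ 2 + 1) <= i.+4.+1 * (i.+4 ^ 2 + 1))%N by nia.
rewrite -mulnA; apply: leq_trans (_ : (2 ^ i.+4 * (i.+4.+1 * (i.+4 ^ 2 + 1)) <= _)%N).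
  by rewrite mulnCA leq_mul2l H orbT.
by rewrite mulnCA leq_mul2l IH orbT.
Qed.

(** The bound 32 is the sum of 16 / 2^i; the induction carries the remainder 32 / 2^N along. *)
Lemma sum_sqr_fact (R : realFieldType) m N : (0 < m)%N ->
  \sum_(0 <= i < N) ((i ^ 2 + 1)%:R / (m ^ i * i`!)%:R) <= 32 :> R.
Proof.
move=> m0; suff H : \sum_(0 <= i < N) ((i ^ 2 + 1)%:R / (m ^ i * i`!)%:R) <=
    32 - 32 * (1 / 2) ^+ N :> R.
  by apply: le_trans H _; rewrite gerBl mulr_ge0 // exprn_ge0.
elim: N => [|N IH]; first by rewrite big_geq // expr0; lra.
rewrite big_nat_recr //= exprS.
have H : (N ^ 2 + 1)%:R / (m ^ N * N`!)%:R <= 16 * (1 / 2) ^+ N :> R.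
  rewrite ler_pdivrMr ?ltr0n ?muln_gt0 ?expn_gt0 ?m0 ?fact_gt0 //.
  rewrite expr_div_n expr1n mul1r mulrAC ler_pdivlMr ?exprn_gt0 //.
  rewrite -natrX -!natrM ler_nat.
  have := sqr_le_fact N; have : (0 < m ^ N)%N by rewrite expn_gt0 m0.
  by move: (2 ^ N)%N (N ^ 2)%N (m ^ N)%N => a b d; nia.
move: IH H; move: (_ ^+ N) => y; lra.
Qed.

(** Transfers a lower bound on the spread of the flat weights to the number of blocks. Since (i +
    e)^2 <= 2 (e^2 + 1) (i^2 + 1), the Poisson part costs at most the factor 64 = 2 * 32. *)
Lemma dobinski_second_moment (R : realFieldType) c m n N (mu : R) : (0 < m)%N ->
  \sum_(0 <= j < N) dobinski R c m n j * (j%:R - mu) ^+ 2 <=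
  64 * (stirling_sum c m n (fun k => (k%:R - mu) ^+ 2) + stirling_sum c m n (fun=> 1)).
Proof.
move=> m0; rewrite sum_dobinski // -stirling_sumD -stirling_sumZ.
apply: ler_stirling_sum => k _; set d := (k%:R - mu) ^+ 2.
have d0 : 0 <= d by rewrite sqr_ge0.
apply: (@le_trans _ _ (\sum_(0 <= i < N - k) (2 * (d + 1)) * ((i ^ 2 + 1)%:R / (m ^ i * i`!)%:R))).
  apply: ler_sum => i _; rewrite mulrA ler_wpM2r ?invr_ge0 //.
  rewrite natrD natrD natrX.
  have -> : (i%:R + k%:R - mu) ^+ 2 = (i%:R + (k%:R - mu)) ^+ 2 by congr (_ ^+ _); ring.
  rewrite /d in d0 *; move: (k%:R - mu) d0 => e _; have i0 : 0 <= i%:R :> R by [].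
  have := sqr_ge0 (i%:R - e); have := sqr_ge0 (i%:R * e); move: (i%:R) i0 => y y0; nra.
rewrite -mulr_sumr (le_trans (ler_wpM2l _ (sum_sqr_fact _ _ m0))) //; last by lra.
by rewrite mulr_ge0 // addr_ge0.
Qed.

(** Only the term i = 0 of the Poisson sum is kept; [n < N] makes it present for every k <= n. *)
Lemma dobinski_mass (R : realFieldType) c m n N : (0 < m)%N -> (n < N)%N ->
  stirling_sum c m n (fun=> 1) <= \sum_(0 <= j < N) dobinski R c m n j.
Proof.
move=> m0 nN; rewrite (eq_bigr (fun j => dobinski R c m n j * 1)) => [|j _]; last by rewrite mulr1.
rewrite sum_dobinski //; apply: ler_stirling_sum => k kn.
have -> : (N - k = (N - k).-1.+1)%N by lia.
rewrite big_nat_recl // expn0 fact0 muln1 divr1 lerDl sumr_ge0 //.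
Qed.

Lemma bernoulli_ineq (R : realDomainType) (x : R) n : -1 <= x -> 1 + n%:R * x <= (1 + x) ^+ n.
Proof.
move=> x1; elim: n => [|n IH]; first by rewrite mul0r addr0 expr0.
have x0 : 0 <= 1 + x by rewrite -lerBlDl sub0r.
rewrite exprS; apply: le_trans (ler_wpM2l x0 IH).
by rewrite -natr1; have : 0 <= n%:R :> R by []; move: (n%:R) => y; nra.
Qed.

(** A division-free form of j!^2 / ((j + s)! (j - s)!) >= 1 - s^2 / (j + 1), by induction on s. *)
Lemma fact_shift (R : realDomainType) j s : (s <= j)%N ->
  (j.+1%:R - s%:R ^+ 2) * ((j + s)`! * (j - s)`!)%:R <= j.+1%:R * (j`! ^ 2)%:R :> R.
Proof.
elim: s => [|s IH] sj; first by rewrite addn0 subn0 expr0n subr0 mulnn.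
have {}IH := IH (ltnW sj).
have E : ((j - s)`! = (j - s) * (j - s.+1)`!)%N.
  by rewrite (_ : (j - s = (j - s.+1).+1)%N) ?factS; lia.
have js : 0 < j%:R - s%:R :> R by rewrite subr_gt0 ltr_nat.
rewrite -(ler_pM2l js) -subr_ge0; rewrite -(ler_pM2l js) -subr_ge0 in IH.
rewrite addnS factS; move: IH; rewrite E !natrM (natrB _ (ltnW sj)).
rewrite -!natr1 natrD; set F := ((j + s)`!)%:R; set G := ((j - s.+1)`!)%:R.
move=> IH.
have FG0 : 0 <= F * G :> R by rewrite mulr_ge0 // /F /G.
have s0 : 0 <= s%:R :> R by [].
(* After multiplication by j - s, the gap between the two sides for s + 1 equals the gap for s plus
   [e]. *)
pose e := (j%:R - s%:R) * (F * G) * ((2 * s%:R + 1) * (s%:R ^+ 2 + s%:R)).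
have e0 : 0 <= e :> R by rewrite !mulr_ge0 ?(ltW js) ?addr_ge0 ?mulr_ge0 ?exprn_ge0.
by apply: le_trans (addr_ge0 IH e0) _; rewrite le_eqVlt; apply/orP; left; apply/eqP; rewrite /e; ring.
Qed.

(** The flatness estimate. The powers of m cancel; the two size conditions on j make the ratio of
    the n-th powers and the ratio of the factorials each at least 3/4, and (3/4)^2 >= 1/4. *)
Lemma dobinski_curvature (R : realFieldType) c m n s j :
  (0 < c)%N -> (0 < m)%N -> (s <= j)%N -> (4 * s ^ 2 * n <= j ^ 2)%N -> (4 * s ^ 2 <= j.+1)%N ->
  dobinski R c m n j ^+ 2 <= 4 * (dobinski R c m n (j + s) * dobinski R c m n (j - s)).
Proof.
move=> c0 m0 sj sn s4; pose A : R := (c + m * j)%:R; pose M : R := (m * s)%:R.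
have A0 : 0 < A by rewrite ltr0n addn_gt0 c0.
have An0 : A != 0 by rewrite gt_eqF.
have EP : (c + m * (j + s))%:R = A + M by rewrite mulnDr addnA natrD.
have EM : (c + m * (j - s))%:R = A - M.
  by apply/eqP; rewrite eq_sym subr_eq /A /M -natrD -addnA -mulnDr subnK.
have nM : n%:R * M ^+ 2 * 4 <= A ^+ 2.
  rewrite /A /M -!natrX -!natrM ler_nat.
  apply: (@leq_trans ((m * j) ^ 2)); last by rewrite leq_exp2r // leq_addl.
  by rewrite !expnMn; move: (s ^ 2)%N (j ^ 2)%N (m ^ 2)%N sn => a b d; nia.
have A2 : 0 < A ^+ 2 by rewrite exprn_gt0.
have EA : (c + m * j)%:R = A by [].
clearbody A M.
(* (A + M) (A - M) = A^2 (1 - M^2 / A^2), and Bernoulli's inequality bounds the n-th power of the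
   last factor below by 1 - n M^2 / A^2. *)
have PQ : 3 / 4 * (A ^+ n) ^+ 2 <= (A + M) ^+ n * (A - M) ^+ n.
  case: (posnP n) => [->|n0]; first by rewrite !expr0; lra.
  have x1 : -1 <= - (M ^+ 2 / A ^+ 2).
    rewrite lerN2 ler_pdivrMr // mul1r; apply: le_trans nM.
    have : 1 <= n%:R :> R by rewrite ler1n.
    by have := sqr_ge0 M; move: (M ^+ 2) (n%:R) => a b; nra.
  have -> : (A + M) ^+ n * (A - M) ^+ n = (1 - M ^+ 2 / A ^+ 2) ^+ n * (A ^+ n) ^+ 2.
    by rewrite [(A ^+ n) ^+ 2]exprAC -!(exprMn n); congr (_ ^+ _); field.
  apply: ler_wpM2r; first exact: sqr_ge0.
  apply: le_trans (bernoulli_ineq n x1).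
  suff : n%:R * (M ^+ 2 / A ^+ 2) <= 1 / 4 by lra.
  by rewrite mulrA ler_pdivrMr //; lra.
have FG : 3 / 4 * ((j + s)`! * (j - s)`!)%:R <= (j`! ^ 2)%:R :> R.
  have := fact_shift R sj; have j1 : 0 < j.+1%:R :> R by rewrite ltr0n.
  have : 4 * s%:R ^+ 2 <= j.+1%:R :> R by rewrite -natrX -natrM ler_nat.
  have : 0 <= ((j + s)`! * (j - s)`!)%:R :> R by [].
  set y := (_ * _)%:R; set z := (_ ^ 2)%:R.
  move: (j.+1%:R) j1 (s%:R ^+ 2) y z => a a0 b y z y0 ab.
  have : 0 <= (a - 4 * b) * y by rewrite mulr_ge0 ?subr_ge0.
  move=> ? ?; rewrite -(ler_pM2l a0); lra.
rewrite /dobinski !natrX EP EM EA.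
have F0 : 0 < (j`! ^ 2)%:R :> R by rewrite ltr0n expn_gt0 fact_gt0.
have G0 : 0 < ((j + s)`! * (j - s)`!)%:R :> R by rewrite ltr0n muln_gt0 !fact_gt0.
have mj0 : 0 < ((m ^ j) ^ 2)%:R :> R by rewrite ltr0n !expn_gt0 m0.
have -> : (A ^+ n / (m ^ j * j`!)%:R) ^+ 2 =
    (A ^+ n) ^+ 2 / ((m ^ j) ^ 2)%:R / (j`! ^ 2)%:R.
  by rewrite expr_div_n -natrX expnMn natrM invfM mulrA.
have -> : 4 * ((A + M) ^+ n / (m ^ (j + s) * (j + s)`!)%:R *
      ((A - M) ^+ n / (m ^ (j - s) * (j - s)`!)%:R)) =
    4 * ((A + M) ^+ n * (A - M) ^+ n) / ((m ^ j) ^ 2)%:R / ((j + s)`! * (j - s)`!)%:R.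
  have -> : ((m ^ j) ^ 2 = m ^ (j + s) * m ^ (j - s))%N.
    by rewrite -expnM -expnD; congr expn; lia.
  by rewrite !natrM !invfM; ring.
rewrite mulrAC [leRHS]mulrAC ler_pM2r ?invr_gt0 //.
rewrite ler_pdivrMr // [leRHS]mulrAC ler_pdivlMr //.
move: PQ FG F0 G0 (sqr_ge0 (A ^+ n)); set y := (_ * _)%:R; set z := (_ ^ 2)%:R.
move: ((A ^+ n) ^+ 2) ((A + M) ^+ n * (A - M) ^+ n) y z => a b y z ab yz z0 y0 a0.
have := ler_pM (mulr_ge0 (_ : 0 <= 3 / 4) a0) (mulr_ge0 (_ : 0 <= 3 / 4) (ltW y0)) ab yz.
move=> /(_ ltac:(lra) ltac:(lra)); have := mulr_ge0 a0 (ltW y0); lra.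
Qed.

Lemma dobinski_ratio (R : realFieldType) c m n j : (0 < m)%N ->
  (2 * (m * j.+1) * (c + m * j) ^ n <= (c + m * j.+1) ^ n)%N ->
  2 * dobinski R c m n j <= dobinski R c m n j.+1.
Proof.
move=> m0 H; rewrite /dobinski mulrA.
rewrite ler_pdivrMr ?ltr0n ?muln_gt0 ?expn_gt0 ?m0 ?fact_gt0 // mulrAC.
rewrite ler_pdivlMr ?ltr0n ?muln_gt0 ?expn_gt0 ?m0 ?fact_gt0 //.
rewrite -!natrM ler_nat expnS factS; apply: leq_trans (leq_mul H (leqnn _)).
by apply/eq_leq; ring.
Qed.

(** As long as the weights at least double, everything before J weighs no more than the term at
    J. *)
Lemma dobinski_head (R : realFieldType) c m n J :
  (forall j, (j < J)%N -> 2 * dobinski R c m n j <= dobinski R c m n j.+1) ->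
  \sum_(0 <= j < J) dobinski R c m n j <= dobinski R c m n J.
Proof.
elim: J => [|J IH] H; first by rewrite big_geq // dobinski_ge0.
rewrite big_nat_recr //=; apply: le_trans (H J (leqnn _)).
by rewrite mulr_natl mulr2n lerD2r; apply: IH => j jJ; apply: H; apply: leqW.
Qed.

(** A cut [j0] of order sqrt(n) serves both purposes: it is large enough for the flatness estimate
    beyond it, and small enough for the weights to double before it, where consecutive n-th powers
    have a ratio growing faster than [j0]. *)
Lemma dobinski_threshold c m s : (0 < c)%N -> (0 < m)%N -> (0 < s)%N ->
  exists N, forall n, (N <= n)%N -> exists j0,
    [/\ (4 * s ^ 2 * n <= j0 ^ 2)%N, (4 * s ^ 2 <= j0)%N, (s <= j0)%N &
     forall j, (j < j0)%N -> (2 * (m * j.+1) * (c + m * j) ^ n <= (c + m * j.+1) ^ n)%N].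
Proof.
(* With q the integer part of sqrt(n) and j0 = 2 s (q + 1), [eta] bounds q m / (a j0) from below,
   independently of n. *)
move=> c0 m0 s0; pose a := (c + m)%N; pose eta : rat := m%:R / (4 * s * a)%:R.
have a0 : (0 < a)%N by rewrite addn_gt0 c0.
have m0' : 0 < m%:R :> rat by rewrite ltr0n.
have eta0 : 0 < eta by rewrite divr_gt0 // ltr0n !muln_gt0 s0 a0.
pose K : rat := (16 * m * s)%:R / eta ^+ 2.
pose p0 := (Num.truncn K).+1; have Kp : K <= p0%:R by apply/ltW/truncnS_gt.
pose q0 := (2 * p0 + 2 * s + 2)%N; exists (q0 ^ 2)%N => n nN.
have [q /andP[qn nq]] : exists q, (q ^ 2 <= n < q.+1 ^ 2)%N.
  elim: (n) => [|k [q /andP[qk kq]]]; first by exists 0%N.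
  case: (ltnP k.+1 (q.+1 ^ 2)) => H; first by exists q; rewrite H (leq_trans qk).
  by exists q.+1; rewrite H; nia.
have qq0 : (q0 <= q)%N by rewrite -ltnS -(ltn_exp2r _ _ (e := 2)) //; apply: leq_ltn_trans nq.
exists (2 * s * q.+1)%N; split; [nia|nia|nia|] => j jj.
pose j0 := (2 * s * q.+1)%N; pose x : rat := m%:R / (a * j0)%:R.
have j00 : (0 < j0)%N by rewrite !muln_gt0 s0.
have Aj : (c + m * j <= a * j0)%N by rewrite /a -/j0 in jj *; nia.
have q1 : (0 < q)%N by lia.
have x0 : 0 < x by rewrite divr_gt0 // ltr0n muln_gt0 a0 j00.
have xq : eta <= q%:R * x.
  rewrite /eta /x mulrCA ler_pM2l // ler_pdivlMr; last first.
    by rewrite ltr0n muln_gt0 a0 j00.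
  rewrite mulrC ler_pdivrMr ?ltr0n ?muln_gt0 ?s0 ?a0 // -!natrM ler_nat /j0.
  by clear -q1; nia.
have p1 : (p0.+1 <= q./2)%N by rewrite /q0 in qq0; lia.
have pos1 : 0 < 1 + x by rewrite addr_gt0.
(* Bernoulli's inequality is used twice: (1 + x)^q >= 1 + eta, then (1 + eta)^(q/2) >= (q/2) eta.
   The square of the latter is quadratic in q, while [j0] is linear; [K] and [p0] say when it
   wins. *)
have big : (2 * (m * j0))%:R <= (1 + x) ^+ n.
  apply: (@le_trans _ _ ((1 + x) ^+ (q ^ 2))); last by rewrite ler_weXn2l // lerDl ltW.
  rewrite -mulnn exprM; apply: (@le_trans _ _ ((1 + eta) ^+ q)); last first.
    rewrite lerXn2r ?nnegrE ?exprn_ge0 ?(ltW pos1) ?addr_ge0 ?(ltW eta0) //.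
    apply: le_trans (bernoulli_ineq _ _); first by rewrite lerD2l.
    by apply: le_trans (ltW x0).
  apply: (@le_trans _ _ ((1 + eta) ^+ (q./2 * 2))); last first.
    by rewrite ler_weXn2l ?lerDl ?(ltW eta0) //; lia.
  rewrite exprM; apply: (@le_trans _ _ ((q./2)%:R ^+ 2 * eta ^+ 2)); last first.
    rewrite -exprMn lerXn2r ?nnegrE ?exprn_ge0 ?mulr_ge0 ?addr_ge0 ?(ltW eta0) //.
    apply: le_trans (bernoulli_ineq _ _); first by rewrite lerDr.
    by apply: le_trans (ltW eta0).
  have e2 : 0 < eta ^+ 2 by rewrite exprn_gt0.
  rewrite -ler_pdivrMr //; apply: (@le_trans _ _ ((q./2)%:R * K)); last first.
    rewrite expr2 ler_wpM2l //; apply: le_trans Kp _.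
    by rewrite ler_nat ltnW.
  rewrite /K mulrA ler_pM2r ?invr_gt0 // -natrM ler_nat /j0.
  have : (q.+1 <= 4 * q./2)%N by lia.
  by clear; nia.
rewrite -(ler_nat rat) natrM !natrX.
have AM : (c + m * j)%:R * (1 + x) <= (c + m * j.+1)%:R :> rat.
  rewrite (_ : (c + m * j.+1 = c + m * j + m)%N); last by lia.
  rewrite [leRHS]natrD mulrDr mulr1 lerD2l /x mulrCA ger_pMr //.
  by rewrite ler_pdivrMr ?mul1r ?ler_nat // ltr0n muln_gt0 a0 j00.
apply: (@le_trans _ _ (((c + m * j)%:R * (1 + x)) ^+ n)); last first.
  by rewrite lerXn2r ?nnegrE ?mulr_ge0 ?(ltW pos1).
rewrite exprMn mulrC ler_wpM2l ?exprn_ge0 //; apply: le_trans big.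
by rewrite ler_nat; rewrite -/j0 in jj; clear -jj; nia.
Qed.

(** The left side is at most 2 sqrt(x y) |d + s| |d - s|, to which the inequality of arithmetic and
    geometric means applies. Comparing squares avoids the roots. *)
Lemma weighted_am_gm (R : realFieldType) (w x y d s : R) :
  0 <= x -> 0 <= y -> w ^+ 2 <= 4 * (x * y) ->
  w * (s ^+ 2 - d ^+ 2) <= x * (d + s) ^+ 2 + y * (d - s) ^+ 2.
Proof.
move=> x0 y0 wxy; apply: (le_trans (ler_norm _)).
have r0 : 0 <= x * (d + s) ^+ 2 + y * (d - s) ^+ 2.
  by apply: addr_ge0; apply: mulr_ge0 => //; exact: sqr_ge0.
rewrite -(ger0_norm r0) -ler_sqr ?nnegrE // !real_normK ?num_real //.
apply: (@le_trans _ _ (4 * (x * y) * (s ^+ 2 - d ^+ 2) ^+ 2)).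
  by rewrite exprMn ler_wpM2r ?sqr_ge0.
by have := sqr_ge0 (x * (d + s) ^+ 2 - y * (d - s) ^+ 2); lra.
Qed.

(** Let T be the total mass, V the second moment about mu, W the weight beyond [j0] and Q the second
    moment of the weights. Summing the flatness estimate gives s^2 W <= 3 Q, while T <= 2 W and Q <=
    64 (V + T). *)
Lemma stirling_variance_large (R : realType) c m (K : R) : (0 < c)%N -> (0 < m)%N ->
  exists N, forall n, (N <= n)%N -> forall mu,
  K * stirling_sum c m n (fun=> 1) <= stirling_sum c m n (fun k => (k%:R - mu) ^+ 2).
Proof.
(* 384 = 2 * 3 * 64 collects the constants of the three inequalities. *)
move=> c0 m0; pose s := (Num.truncn (384 * (K + 1))).+1.
have Ks : 384 * (K + 1) <= s%:R ^+ 2.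
  apply: (@le_trans _ _ s%:R); first exact/ltW/truncnS_gt.
  by rewrite -natrX ler_nat; nia.
have [N H] := @dobinski_threshold c m s c0 m0 isT.
exists N => n /H[j0 [sn s4 sj jj]] mu.
pose w := dobinski R c m n; pose f j := w j * (j%:R - mu) ^+ 2.
have w0 j : 0 <= w j by exact: dobinski_ge0.
have f0 j : 0 <= f j by rewrite mulr_ge0 ?sqr_ge0.
pose N1 := (n + j0).+1; pose Q := \sum_(0 <= j < N1 + s) f j.
have nat_le a b (g : nat -> R) : (forall j, 0 <= g j) -> (b <= N1 + s)%N ->
    \sum_(a <= j < b) g j <= \sum_(0 <= j < N1 + s) g j.
  move=> g0 bN; case: (leqP a b) => ab; last first.
    by rewrite big_geq ?sumr_ge0 // ltnW.
  rewrite [leRHS](big_cat_nat (n := b)) //= [X in _ <= X + _](big_cat_nat (n := a)) //=.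
  by rewrite -addrA addrCA lerDl addr_ge0 ?sumr_ge0.
have pair j : (j0 <= j)%N -> w j * (s%:R ^+ 2 - (j%:R - mu) ^+ 2) <= f (j + s)%N + f (j - s)%N.
  move=> j0j; have sj' : (s <= j)%N by exact: leq_trans j0j.
  rewrite /f natrD natrB // -!addrA [s%:R - _]addrC [- s%:R - _]addrC !addrA.
  apply: weighted_am_gm => //; apply: dobinski_curvature => //.
    by apply: leq_trans sn _; rewrite leq_exp2r.
  by apply: leq_trans s4 _; rewrite leqW.
have mass : stirling_sum c m n (fun=> 1) <= 2 * \sum_(j0 <= j < N1) w j.
  apply: le_trans (@dobinski_mass R c m n N1 m0 _) _; first by rewrite /N1; lia.
  have jN : (j0 < N1)%N by rewrite /N1; lia.
  rewrite (big_cat_nat (n := j0)) //= ?(ltnW jN) // mulr_natl mulr2n lerD2r.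
  apply: le_trans (@dobinski_head R c m n j0 _) _.
    by move=> j /jj; exact: dobinski_ratio.
  by rewrite big_ltn // lerDl sumr_ge0.
have sumf : \sum_(j0 <= j < N1) f (j + s)%N + \sum_(j0 <= j < N1) f (j - s)%N <= 2 * Q.
  rewrite mulr_natl mulr2n lerD //.
    have <- : \sum_(j0 + s <= j < N1 + s) f j = \sum_(j0 <= j < N1) f (j + s)%N.
      by rewrite big_addn addnK.
    exact: nat_le.
  rewrite -{1}(subnK sj) big_addn; apply: le_trans (nat_le 0%N (N1 - s)%N f f0 _); last first.
    by lia.
  rewrite [leRHS](big_cat_nat (n := (j0 - s)%N)) //=; last by rewrite /N1; lia.
  rewrite (eq_bigr f) => [|i _]; last by rewrite addnK.
  by rewrite lerDr sumr_ge0.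
have main : s%:R ^+ 2 * \sum_(j0 <= j < N1) w j <= 3 * Q.
  have : \sum_(j0 <= j < N1) w j * (s%:R ^+ 2 - (j%:R - mu) ^+ 2) <= 2 * Q.
    apply: le_trans sumf; rewrite -big_split /= big_nat [leRHS]big_nat.
    by apply: ler_sum => j /andP[j0j _]; exact: pair.
  rewrite (eq_bigr (fun j => s%:R ^+ 2 * w j - f j)); last first.
    by move=> j _; rewrite /f; ring.
  rewrite sumrB -mulr_sumr; have := nat_le j0 N1 f f0 (leq_addr _ _); rewrite -/Q; lra.
have := dobinski_second_moment c n (N1 + s) mu m0; rewrite -/Q.
have T0 := stirling_sum1_gt0 R m n c0; move: T0 mass main Ks.
set T := stirling_sum _ _ _ _; set V := stirling_sum _ _ _ _; set W := \sum_(j0 <= j < N1) w j.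
move: (s%:R ^+ 2) => S T0 TW SW KS QV.
have W0 : 0 <= W by exact: sumr_ge0.
have : 384 * (K + 1) * W <= S * W by rewrite ler_wpM2r.
have := sumr_ge0; move: W W0 TW SW => W W0 TW SW _ KW.
case: (leP (K + 1) 0) => K1; last first.
  have : (K + 1) * T <= (K + 1) * (2 * W) by rewrite ler_wpM2l // ltW.
  by rewrite mulrDl mul1r; lra.
apply: (@le_trans _ _ 0); first by rewrite mulr_le0_ge0 ?(ltW T0) //; lra.
rewrite /V -[leLHS](mul0r T) -stirling_sumZ; apply: ler_stirling_sum => k _.
by rewrite mul0r sqr_ge0.
Qed.

(** * The Stein equation for the normal law *)

Import numFieldNormedType.Exports.
Local Open Scope classical_set_scope.
Local Open Scope ring_scope.

Lemma is_derive_mvt (R : realType) (f df : R -> R) (a b : R) :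
  (forall x : R, is_derive x 1 f (df x)) -> a < b ->
  exists2 x, a < x < b & f b - f a = df x * (b - a).
Proof.
move=> dff ab; have cf : {within `[a, b], continuous f}.
  by apply: derivable_within_continuous => x _; case: (dff x).
have [x] := @MVT R f df a b ab (fun x _ => dff x) cf.
by rewrite in_itv /= => xab ->; exists x.
Qed.

Lemma is_derive_lipschitz (R : realType) (f df : R -> R) (C : R) :
  (forall x : R, is_derive x 1 f (df x)) -> (forall x, `|df x| <= C) ->
  forall x y, `|f x - f y| <= C * `|x - y|.
Proof.
move=> dff dfC x y; wlog xy : x y / y < x => [H|].
  case: (ltgtP x y) => [|/H//|->]; last by rewrite !subrr normr0 mulr0.
  by move=> /H; rewrite distrC [`|y - x|]distrC.
have [z _ ->] := is_derive_mvt dff xy.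
by rewrite normrM ler_wpM2r.
Qed.

(** Gives derivatives from an explicit second-order remainder; it serves for y^2 / 2 and for the
    piecewise quadratic primitives of ramps. *)
Lemma is_derive_quadratic (R : realType) (f : R -> R) (C x d : R) :
  (forall t, `|f (x + t) - f x - t * d| <= C * t ^+ 2) -> is_derive x 1 f d.
Proof.
move=> fC; apply/is_derive1_caratheodory.
exists (fun z => if z == x then d else (f z - f x) / (z - x)); split.
- move=> z; case: eqP => [->|/eqP]; first by rewrite !subrr mulr0.
  by rewrite -subr_eq0 => /divfK->.
- apply/cvgrPdist_le => /= e e0; near=> z; rewrite eqxx.
  case: eqP => [_|/eqP zx]; first by rewrite subrr normr0 ltW.
  have zx0 : 0 < `|z - x| by rewrite normr_gt0 subr_eq0.
  rewrite -(ler_pM2r zx0) -normrM mulrBl divfK ?subr_eq0 // distrC.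
  have := fC (z - x); rewrite [x + _]addrC subrK [(z - x) * d]mulrC => /le_trans; apply.
  rewrite -[(z - x) ^+ 2]real_normK ?num_real // expr2 mulrA ler_pM2r //.
  apply: (@le_trans _ _ ((`|C| + 1) * `|z - x|)).
    by rewrite ler_wpM2r // (le_trans (ler_norm C)) // lerDl.
  have C1 : 0 < `|C| + 1 by rewrite ltr_wpDl.
  rewrite mulrC -ler_pdivlMr // distrC; near: z.
  by apply: cvgr_dist_le; [exact: cvg_id|exact: divr_gt0].
- by rewrite eqxx.
Unshelve. all: by end_near. Qed.

Definition normal_cdf (R : realType) (x : R) : R :=
  (\int[lebesgue_measure]_(t in `]-oo, x]) normal_pdf 0 1 t)%R.

Lemma normal_prob_cdf (R : realType) (x : R) :
  normal_prob (0 : R) 1 `]-oo, x] = (normal_cdf x)%:E.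
Proof.
rewrite /normal_cdf /Rintegral fineK //.
rewrite -[X in X \is a fin_num]/(normal_prob (0 : R) 1 `]-oo, x]).
exact: fin_num_measure.
Qed.

Lemma is_derive_normal_cdf (R : realType) (x : R) :
  is_derive x 1 (@normal_cdf R) (normal_pdf 0 1 x).
Proof.
have cpdf : {for x, continuous (@normal_pdf R 0 1)}.
  by apply: continuous_normal_pdf; exact: oner_neq0.
have [|//|dF FE] := @continuous_FTC1 R (@normal_pdf R 0 1) -oo%O x (x + 1) _ _ (ltNyr _) cpdf.
- by rewrite ltrDl.
- apply: integrableS (integrable_normal_pdf 0 1) => //.
constructor; first exact: dF.
by rewrite -derive1E; exact: FE.
Qed.

Lemma normal_pdf_gt0 (R : realType) (x : R) : 0 < normal_pdf 0 1 x.
Proof.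
by rewrite /normal_pdf oner_eq0 mulr_gt0 ?expR_gt0 // normal_peak_gt0.
Qed.

Lemma is_derive_normal_pdf (R : realType) (x : R) :
  is_derive x 1 (@normal_pdf R 0 1) (- x * normal_pdf 0 1 x).
Proof.
have d1 : is_derive x 1 (fun y : R => - (y ^+ 2 / 2)) (- x).
  apply: (@is_derive_quadratic _ _ (1 / 2)) => t.
  rewrite (_ : _ - _ = - (1 / 2 * t ^+ 2)); last by field.
  by rewrite normrN ger0_norm // mulr_ge0 ?sqr_ge0.
have d2 := @is_derive1_comp R expR (fun y => - (y ^+ 2 / 2)) x _ _ (is_derive_expR _) d1.
have d3 := is_deriveZ (normal_peak 1 : R) d2.
rewrite (_ : normal_pdf 0 1 = normal_peak 1 \*: (expR \o (fun y : R => - (y ^+ 2 / 2)))); last first.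
  apply/funext => y; rewrite /normal_pdf oner_eq0 /normal_fun /=; congr (_ * expR _).
  by rewrite subr0 expr1n mulNr.
apply: (is_derive_eq d3).
by rewrite -[LHS]/(normal_peak 1 * (expR (- (x ^+ 2 / 2)) * - x)) mulrA mulrC.
Qed.

Lemma normal_cdf_ge0 (R : realType) (x : R) : 0 <= normal_cdf x.
Proof.
by apply: fine_ge0; apply: integral_ge0 => t _; rewrite lee_fin normal_pdf_ge0.
Qed.

Lemma normal_cdf_le1 (R : realType) (x : R) : normal_cdf x <= 1.
Proof.
rewrite -lee_fin -normal_prob_cdf -(@integral_normal_pdf R 0 1).
apply: ge0_subset_integral => //.
  by case/integrableP : (integrable_normal_pdf (0 : R) 1).
by move=> t _; rewrite lee_fin normal_pdf_ge0.
Qed.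

Lemma normal_cdf_lt (R : realType) (x y : R) : x < y -> normal_cdf x < normal_cdf y.
Proof.
move=> xy; have [z _ E] := is_derive_mvt (@is_derive_normal_cdf R) xy.
by rewrite -subr_gt0 E mulr_gt0 ?normal_pdf_gt0 ?subr_gt0.
Qed.

(** Continuity of the normal measure along the half-lines ending at n and at -n. *)
Lemma normal_cdf_tail (R : realType) (e : R) : 0 < e ->
  exists2 L, 0 < L & normal_cdf (- L) <= e /\ 1 - e <= normal_cdf L.
Proof.
move=> e0.
pose A (n : nat) : set R := [set` `]-oo, n%:R : R]].
pose B (n : nat) : set R := [set` `]-oo, - n%:R : R]].
have cy : normal_prob (0 : R) 1 (A n) @[n --> \oo] --> 1%:E.
  have UA : \bigcup_n A n = setT.
    rewrite -subTset => t _ /=.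
    by exists (Num.truncn t).+1; rewrite //= /A /= in_itv /= ltW // truncnS_gt.
  have <- : normal_prob (0 : R) 1 (\bigcup_n A n) = 1%:E by rewrite UA; exact: probability_setT.
  apply: nondecreasing_cvg_mu => //.
  - by move=> n; exact: measurable_itv.
  - by apply: bigcup_measurable => n _; exact: measurable_itv.
  move=> n m nm; apply/subsetPset => x /=; rewrite /A /= !in_itv /= => /le_trans.
  by apply; rewrite ler_nat.
have cNy : normal_prob (0 : R) 1 (B n) @[n --> \oo] --> 0%:E.
  have IB : \bigcap_n B n = set0.
    rewrite -subset0 => t /(_ (Num.truncn (- t)).+1 I) /=.
    by rewrite /B /= in_itv /= leNgt => /negP; apply; rewrite ltrNl truncnS_gt.
  have <- : normal_prob (0 : R) 1 (\bigcap_n B n) = 0%:E by rewrite IB; exact: measure0.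
  apply: nonincreasing_cvg_mu => //.
  - rewrite -[X in (X < _)%E]/(normal_prob (0 : R) 1 `]-oo, - 0%:R]).
    by rewrite normal_prob_cdf ltry.
  - by move=> n; exact: measurable_itv.
  - by apply: bigcap_measurable => // n _; exact: measurable_itv.
  move=> m n mn; apply/subsetPset => x /=; rewrite /B /= !in_itv /= => /le_trans.
  by apply; rewrite lerN2 ler_nat.
have /fine_cvg cy' : (normal_cdf (n%:R : R))%:E @[n --> \oo] --> 1%:E.
  by apply: cvg_trans cy; apply: near_eq_cvg; near=> n; rewrite -normal_prob_cdf.
have /fine_cvg cNy' : (normal_cdf (- n%:R : R))%:E @[n --> \oo] --> 0%:E.
  by apply: cvg_trans cNy; apply: near_eq_cvg; near=> n; rewrite -normal_prob_cdf.
move/cvgrPdist_le : cy' => /(_ _ e0) cy'; move/cvgrPdist_le : cNy' => /(_ _ e0) cNy'.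
have [N _ H] := filterI cy' cNy'.
exists N.+1%:R; first by rewrite ltr0n.
have [] := H N.+1 (leqnSn N); rewrite /= sub0r normrN.
rewrite !ger0_norm ?subr_ge0 ?normal_cdf_le1 ?normal_cdf_ge0 //.
by move=> *; split; lra.
Unshelve. all: by end_near. Qed.

(** * Ramp functions, their primitives and Stein solutions *)

Definition ramp (R : realFieldType) (a h u : R) : R :=
  (Num.max 0 (u - a) - Num.max 0 (u - a - h)) / h.

Definition ramp_integral (R : realFieldType) (a h u : R) : R :=
  (Num.max 0 (u - a) ^+ 2 / 2 - Num.max 0 (u - a - h) ^+ 2 / 2) / h.

Lemma ramp_lo (R : realFieldType) (a h u : R) : 0 < h -> u <= a -> ramp a h u = 0.
Proof. by move=> h0 ua; rewrite /ramp !max_l ?subrr ?mul0r //; lra. Qed.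

Lemma ramp_hi (R : realFieldType) (a h u : R) : 0 < h -> a + h <= u -> ramp a h u = 1.
Proof.
move=> h0 ua; rewrite /ramp !max_r; [|lra|lra].
by rewrite (_ : _ - _ = h) ?divff ?gt_eqF //; ring.
Qed.

Lemma ramp_itv (R : realFieldType) (a h u : R) : 0 < h -> 0 <= ramp a h u <= 1.
Proof.
move=> h0; rewrite /ramp; apply/andP; split.
  by rewrite divr_ge0 ?(ltW h0) //; rewrite !maxEle; do 2!case: ifP; lra.
by rewrite ler_pdivrMr // mul1r !maxEle; do 2!case: ifP; lra.
Qed.

Lemma ramp_lipschitz (R : realFieldType) (a h u v : R) : 0 < h ->
  `|ramp a h u - ramp a h v| <= h^-1 * `|u - v|.
Proof.
move=> h0; rewrite /ramp -mulrBl normrM mulrC (ger0_norm (_ : 0 <= h^-1)) ?invr_ge0 ?(ltW h0) //.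
rewrite ler_pM2l ?invr_gt0 //; apply/ler_normlP.
have := ler_norm (u - v); have := ler_norm (- (u - v)); rewrite normrN.
move: (`|u - v|) => d d1 d2; rewrite !maxEle; split; do 4!case: ifP; lra.
Qed.

Lemma ramp_integral_lo (R : realFieldType) (a h u : R) :
  0 < h -> u <= a -> ramp_integral a h u = 0.
Proof. by move=> h0 ua; rewrite /ramp_integral !max_l ?subrr ?mul0r //; lra. Qed.

Lemma ramp_integral_hi (R : realFieldType) (a h u : R) : 0 < h -> a + h <= u ->
  ramp_integral a h u = u - a - h / 2.
Proof.
move=> h0 ua; rewrite /ramp_integral !max_r; [|lra|lra].
by field; rewrite gt_eqF.
Qed.

(** Half the square of a positive part has a second-order remainder of at most t^2, even across the
    kink; two such terms divided by h give the constant 2 / h. *)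
Lemma is_derive_ramp_integral (R : realType) (a h u : R) : 0 < h ->
  is_derive u 1 (ramp_integral a h) (ramp a h u).
Proof.
move=> h0; have q (y t : R) :
    `|Num.max 0 (y + t) ^+ 2 / 2 - Num.max 0 y ^+ 2 / 2 - t * Num.max 0 y| <= t ^+ 2.
  apply/ler_normlP; rewrite !maxEle; split; do 2!case: ifP => *; nra.
apply: (@is_derive_quadratic _ _ (2 / h)) => t.
rewrite /ramp_integral /ramp.
have := q (u - a) t; have := q (u - a - h) t.
rewrite (_ : u - a - h + t = u + t - a - h); last by ring.
rewrite (_ : u - a + t = u + t - a); last by ring.
set A := Num.max 0 (u + t - a - h); set B := Num.max 0 (u - a - h).
set C := Num.max 0 (u + t - a); set D := Num.max 0 (u - a) => H1 H2.
rewrite (_ : _ - _ = ((C ^+ 2 / 2 - D ^+ 2 / 2 - t * D) - (A ^+ 2 / 2 - B ^+ 2 / 2 - t * B)) / h).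
  rewrite normrM (ger0_norm (_ : 0 <= h^-1)) ?invr_ge0 ?(ltW h0) // [leRHS]mulrAC ler_pM2r ?invr_gt0 //.
  by rewrite (le_trans (ler_normB _ _)) // mulr_natl mulr2n lerD.
by field; rewrite gt_eqF.
Qed.

Lemma is_derive_div (R : realType) (f g : R -> R) (w df dg : R) : g w != 0 ->
  is_derive w 1 f df -> is_derive w 1 g dg ->
  is_derive w 1 (fun x => f x / g x) ((df * g w - f w * dg) / g w ^+ 2).
Proof.
move=> g0 dff dgg; have d2 := @is_deriveV R g w _ 1 g0 dgg.
apply: (is_derive_eq (is_deriveM dff d2)).
rewrite -[LHS]/(f w * (- (g w) ^- 2 * dg) + (g w)^-1 * df).
by field.
Qed.

(** The derivative of Psi o Phi is (psi o Phi) phi, and that of 1 / phi is x / phi; hence F' - x F =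
    psi o Phi. *)
Lemma stein_solution (R : realType) (Psi psi : R -> R) (w : R) :
  (forall u : R, is_derive u 1 Psi (psi u)) ->
  let F x := Psi (normal_cdf x) / normal_pdf 0 1 x in
  is_derive w 1 F (psi (normal_cdf w) + w * F w).
Proof.
move=> dPsi F; have p0 : normal_pdf 0 1 w != 0 by rewrite gt_eqF ?normal_pdf_gt0.
have d1 := @is_derive1_comp R Psi (@normal_cdf R) w _ _ (dPsi _) (is_derive_normal_cdf w).
have d2 := is_derive_div p0 d1 (is_derive_normal_pdf w).
rewrite (_ : psi _ + _ = (psi (normal_cdf w) * normal_pdf 0 1 w * normal_pdf 0 1 w -
  (Psi \o @normal_cdf R) w * (- w * normal_pdf 0 1 w)) / normal_pdf 0 1 w ^+ 2).
  exact: d2.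
rewrite /F /comp; move: (normal_pdf 0 1 w) p0 (Psi _) (psi _) => p p0 a b.
by field.
Qed.

Lemma lipschitz_continuous_real (R : realType) (f : R -> R) (K : R) :
  (forall x y, `|f x - f y| <= K * `|x - y|) -> continuous f.
Proof.
move=> fK x; apply/cvgrPdist_le => /= e e0; near=> y.
apply: le_trans (fK x y) _; apply: (@le_trans _ _ ((`|K| + 1) * `|x - y|)).
  by rewrite ler_wpM2r // (le_trans (ler_norm K)) // lerDl.
have K1 : 0 < `|K| + 1 by rewrite ltr_wpDl.
rewrite mulrC -ler_pdivlMr //; near: y.
by apply: cvgr_dist_le; [exact: cvg_id|exact: divr_gt0].
Unshelve. all: by end_near. Qed.

(** The term psi o Phi is Lipschitz as a composition. The derivative [G] of x F(x) is continuous and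
    vanishes outside [-L, L], hence is bounded. *)
Lemma stein_solution_lipschitz (R : realType) (Psi psi : R -> R) (K k : R) :
  (forall u : R, is_derive u 1 Psi (psi u)) ->
  (forall u v, `|psi u - psi v| <= K * `|u - v|) -> 0 < k ->
  (forall u, u <= k -> Psi u = 0 /\ psi u = 0) ->
  (forall u, 1 - k <= u -> Psi u = 0 /\ psi u = 0) ->
  let F x := Psi (normal_cdf x) / normal_pdf 0 1 x in
  exists C, forall x y, `|(psi (normal_cdf x) + x * F x) -
                         (psi (normal_cdf y) + y * F y)| <= C * `|x - y|.
Proof.
move=> dPsi psiK k0 lo hi F.
have dF (w : R) : is_derive w 1 F (psi (normal_cdf w) + w * F w) by exact: stein_solution.
have [L L0 [LN LP]] := normal_cdf_tail k0.
have out w : L <= `|w| -> Psi (normal_cdf w) = 0 /\ psi (normal_cdf w) = 0.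
  rewrite ler_normr => /orP[Lw|Lw]; [apply: hi|apply: lo].
    by case: (ltgtP L w) Lw => [/normal_cdf_lt/ltW/(le_trans LP)||<-].
  apply: le_trans LN; case: (ltgtP w (- L)) => [/normal_cdf_lt/ltW//| |->//].
  by move: Lw; lra.
have psiL x y : `|psi (normal_cdf x) - psi (normal_cdf y)| <= `|K| * normal_peak 1 * `|x - y|.
  apply: le_trans (psiK _ _) _; rewrite -mulrA.
  apply: le_trans (ler_wpM2r (normr_ge0 _) (ler_norm K)) _; rewrite ler_wpM2l //.
  apply: (is_derive_lipschitz (@is_derive_normal_cdf R)) => z.
  by rewrite ger0_norm ?normal_pdf_ge0 // normal_pdf_ub // oner_neq0.
have cF : continuous F.
  by move=> w; apply/differentiable_continuous/derivable1_diffP; case: (dF w).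
have cpsi : continuous (psi \o @normal_cdf R) by exact: lipschitz_continuous_real psiL.
pose G w := F w + w * (psi (normal_cdf w) + w * F w).
have dG (w : R) : is_derive w 1 (fun x => x * F x) (G w).
  apply: (is_derive_eq (is_deriveM (is_derive_id w (1 : R)) (dF w))).
  rewrite -[LHS]/(w * (psi (normal_cdf w) + w * F w) + F w * 1) /G.
  by move: (F w) (psi _) => a b; ring.
have cG : continuous G.
  move=> w; apply: cvgD; first exact: cF.
  apply: cvgM; first exact: cvg_id.
  apply: cvgD; first exact: cpsi.
  by apply: cvgM; [exact: cvg_id|exact: cF].
have [M GM] : exists M, forall w, `|G w| <= M.
  have LL : - L <= L by lra.
  have [c _ cmax] := @EVT_max R (fun w => `|G w|) (- L) L LL
    (continuous_subspaceT (fun w => cvg_norm (cG w))).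
  exists `|G c| => w; case: (leP `|w| L) => [wL|/ltW/out[P0 p0]].
    by apply: cmax; rewrite in_itv /= -ler_norml.
  have -> : G w = 0 by rewrite /G /F P0 p0 !(mul0r, mulr0, addr0).
  by rewrite normr0.
exists (`|K| * normal_peak 1 + M) => x y.
rewrite (_ : _ - _ = (psi (normal_cdf x) - psi (normal_cdf y)) + (x * F x - y * F y)); last by ring.
rewrite mulrDl (le_trans (ler_normD _ _)) // lerD //.
exact: (is_derive_lipschitz dG).
Qed.

(** Stein's identity for g(k) = F(W k). Second differences of [g] are at most 2 C / v, which
    contributes 2 C / sd; replacing F'(W k) by a difference quotient of step 1 / sd costs another C
    / sd. *)
Lemma stein_normalized (R : realType) (s : seq R) (F dF : R -> R) (C : R) :
  {in s, forall p, 0 <= p <= 1} ->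
  (forall x : R, is_derive x 1 F (dF x)) ->
  (forall x y, `|dF x - dF y| <= C * `|x - y|) ->
  let mu := \sum_(p <- s) p in let sd := Num.sqrt (\sum_(p <- s) p * (1 - p)) in
  let W (k : nat) := (k%:R - mu) / sd in
  0 < sd ->
  `|bernoulli_sum s (fun k => dF (W k) - W k * F (W k))| <= 3 * C / sd.
Proof.
move=> s01 dFF dFC mu; set v := \sum_(p <- s) p * (1 - p) => sd W sd0.
have v0 : 0 <= v.
  by rewrite /v big_seq sumr_ge0 // => p /s01 /andP[p0 p1]; rewrite mulr_ge0 // subr_ge0.
have vE : v = sd ^+ 2 by rewrite sqr_sqrtr.
have C0 : 0 <= C by have := dFC 1 0; rewrite subr0 normr1 mulr1 => /(le_trans (normr_ge0 _)).
have eta0 : 0 < sd^-1 by rewrite invr_gt0.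
have sdn0 : sd != 0 by rewrite gt_eqF.
have WS k : W k.+1 = W k + sd^-1 by rewrite /W -natr1; ring.
have step k : exists2 z, W k < z < W k.+1 & F (W k.+1) - F (W k) = dF z / sd.
  have lt : W k < W k.+1 by rewrite WS ltrDl.
  have [z zk ->] := is_derive_mvt dFF lt; exists z => //.
  by rewrite WS addrAC subrr add0r.
have D2 k : `|F (W k.+2) - F (W k.+1) *+ 2 + F (W k)| <= 2 * C / v.
  have [z1 /andP[a1 b1] e1] := step k; have [z2 /andP[a2 b2] e2] := step k.+1.
  rewrite (_ : _ + _ = (F (W k.+2) - F (W k.+1)) - (F (W k.+1) - F (W k))); last by ring.
  rewrite e1 e2 -mulrBl normrM (ger0_norm (ltW eta0)).
  have zz : `|z2 - z1| <= 2 / sd.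
    move: a1 b1 a2 b2; rewrite !WS; move: (sd^-1) (W k) eta0 => e x e0 *.
    by apply/ler_normlP; split; lra.
  rewrite vE expr2 invfM mulrA ler_pM2r //; apply: le_trans (dFC _ _) _.
  by rewrite [2 * C]mulrC -mulrA ler_wpM2l.
have := @stein_bernoulli R s (fun k => F (W k)) _ s01 D2; rewrite /= -/mu -/v.
pose X := bernoulli_sum s (fun k => (k%:R - mu) * F (W k)).
pose Y := bernoulli_sum s (fun k => F (W k.+1) - F (W k)).
rewrite -/X -/Y => XY.
have -> : bernoulli_sum s (fun k => dF (W k) - W k * F (W k)) =
   bernoulli_sum s (fun k => dF (W k) - sd * (F (W k.+1) - F (W k))) - (X - v * Y) / sd.
  rewrite !bernoulli_sumB bernoulli_sumZ -/Y.
  have -> : bernoulli_sum s (fun k => W k * F (W k)) = sd^-1 * X.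
    by rewrite -bernoulli_sumZ; apply: bernoulli_sum_ext => k; rewrite /W; ring.
  rewrite vE; move: (bernoulli_sum s (fun k => dF (W k))) X Y {XY} => a b d.
  by move: (sd) sdn0 => e e0; field.
rewrite (le_trans (ler_normB _ _)) // (_ : 3 * C / sd = C / sd + 2 * C / sd); last by field.
apply: lerD.
  apply: bernoulli_sum_norm_le => // k; have [z /andP[a b] ->] := step k.
  rewrite mulrCA divff // mulr1; apply: le_trans (dFC _ _) _; rewrite ler_wpM2l //.
  by move: a b; rewrite WS => a b; apply/ler_normlP; split; lra.
rewrite normrM (ger0_norm (ltW eta0)) ler_pM2r //; apply: le_trans XY _.
by rewrite mulrCA divff ?mulr1 // vE expf_neq0.
Qed.

(** * Central limit theorem *)

Lemma normal_cdf_gt0 (R : realType) (x : R) : 0 < normal_cdf x.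
Proof. by apply: le_lt_trans (normal_cdf_ge0 (x - 1)) (normal_cdf_lt _); lra. Qed.

Lemma normal_cdf_lt1 (R : realType) (x : R) : normal_cdf x < 1.
Proof. by apply: lt_le_trans (normal_cdf_lt (_ : x < x + 1)) (normal_cdf_le1 _); lra. Qed.

Lemma ltr_normal_cdf (R : realType) (x y : R) : (normal_cdf x < normal_cdf y) = (x < y).
Proof.
case: (ltgtP x y) => [/normal_cdf_lt//|/normal_cdf_lt/ltW|->]; last by rewrite ltxx.
by rewrite leNgt => /negPf.
Qed.

Definition standardize (R : realType) (s : seq R) (k : nat) : R :=
  (k%:R - \sum_(p <- s) p) / Num.sqrt (\sum_(p <- s) p * (1 - p)).

Lemma stein_test_function (R : realType) (Psi psi : R -> R) (K k e : R) :
  (forall u : R, is_derive u 1 Psi (psi u)) ->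
  (forall u v, `|psi u - psi v| <= K * `|u - v|) -> 0 < k ->
  (forall u, u <= k -> Psi u = 0 /\ psi u = 0) ->
  (forall u, 1 - k <= u -> Psi u = 0 /\ psi u = 0) -> 0 < e ->
  exists S, forall s, {in s, forall p, 0 <= p <= 1} ->
    S <= Num.sqrt (\sum_(p <- s) p * (1 - p)) ->
    `|bernoulli_sum s (fun k => psi (normal_cdf (standardize s k)))| <= e.
Proof.
move=> dPsi psiK k0 lo hi e0.
have [C CP] := stein_solution_lipschitz dPsi psiK k0 lo hi.
have C0 : 0 <= C by have := CP 1 0; rewrite subr0 normr1 mulr1 => /(le_trans (normr_ge0 _)).
(* This makes 3 C / sd <= e; the summand 1 keeps sd positive. *)
exists (3 * C / e + 1) => s s01 sdS.
have sd0 : 0 < Num.sqrt (\sum_(p <- s) p * (1 - p)).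
  by apply: lt_le_trans sdS; rewrite ltr_wpDl // divr_ge0 ?mulr_ge0 // ltW.
have H := stein_normalized s01 (fun w => stein_solution w dPsi) CP sd0.
rewrite (bernoulli_sum_ext s (h := fun j => psi (normal_cdf (standardize s j)) +
  standardize s j * (Psi (normal_cdf (standardize s j)) / normal_pdf 0 1 (standardize s j))
  - standardize s j * (Psi (normal_cdf (standardize s j)) / normal_pdf 0 1 (standardize s j)))).
  apply: le_trans H _; rewrite ler_pdivrMr // -ler_pdivrMl // mulrC.
  by apply: le_trans sdS; rewrite lerDl.
by move=> j; rewrite addrK.
Qed.

(* [a |-> E (ramp a k (Phi W))] is asymptotically affine; the combination of three ramps is
   chosen so that it vanishes near 0 and near 1 together with its primitive. *)
Lemma ramp_mean_affine (R : realType) (k a e : R) : 0 < k -> k <= a -> a <= 1 - 2 * k -> 0 < e ->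
  exists S, forall s, {in s, forall p, 0 <= p <= 1} ->
    S <= Num.sqrt (\sum_(p <- s) p * (1 - p)) ->
    let M b := bernoulli_sum s (fun j => ramp b k (normal_cdf (standardize s j))) in
    `|(1 - 2 * k - a) * M k - (1 - 3 * k) * M a + (a - k) * M (1 - 2 * k)| <= e.
Proof.
move=> k0 ka ak e0; set c1 := 1 - 2 * k - a; set c2 := 1 - 3 * k; set c3 := a - k.
pose psi u := c1 * ramp k k u - c2 * ramp a k u + c3 * ramp (1 - 2 * k) k u.
pose Psi u := c1 * ramp_integral k k u - c2 * ramp_integral a k u
   + c3 * ramp_integral (1 - 2 * k) k u.
have dPsi (u : R) : is_derive u 1 Psi (psi u).
  exact: (is_deriveD (is_deriveB (is_deriveZ c1 (is_derive_ramp_integral k u k0))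
    (is_deriveZ c2 (is_derive_ramp_integral a u k0)))
    (is_deriveZ c3 (is_derive_ramp_integral (1 - 2 * k) u k0))).
have psiK u v : `|psi u - psi v| <= ((`|c1| + `|c2| + `|c3|) * k^-1) * `|u - v|.
  rewrite (_ : psi u - psi v = c1 * (ramp k k u - ramp k k v) - c2 * (ramp a k u - ramp a k v)
    + c3 * (ramp (1 - 2 * k) k u - ramp (1 - 2 * k) k v)); last by rewrite /psi; ring.
  rewrite (le_trans (ler_normD _ _)) // -mulrA [leRHS]mulrDl lerD //; last first.
    by rewrite normrM ler_wpM2l // ramp_lipschitz.
  by rewrite (le_trans (ler_normB _ _)) // [leRHS]mulrDl lerD // normrM ler_wpM2l // ramp_lipschitz.
have lo u : u <= k -> Psi u = 0 /\ psi u = 0.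
  move=> uk; have lob b : k <= b -> ramp b k u = 0 /\ ramp_integral b k u = 0.
    by move=> kb; rewrite ramp_lo ?ramp_integral_lo //; apply: le_trans kb.
  have [|e1 e1'] := lob k; first by [].
  have [|e2 e2'] := lob a; first by [].
  have [|e3 e3'] := lob (1 - 2 * k); first exact: le_trans ak.
  by rewrite /Psi /psi e1 e1' e2 e2' e3 e3' !mulr0 subrr addr0.
(* Near 1 every ramp is 1, and the primitives are affine with slope 1; everything cancels because c1
   - c2 + c3 = 0 and c1 k - c2 a + c3 (1 - 2 k) = 0. *)
have hi u : 1 - k <= u -> Psi u = 0 /\ psi u = 0.
  move=> uk; have hib b : b <= 1 - 2 * k -> ramp b k u = 1 /\
      ramp_integral b k u = u - b - k / 2.
    by move=> bk; rewrite ramp_hi ?ramp_integral_hi //; lra.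
  have [|e1 e1'] := hib k; first exact: le_trans ak.
  have [|e2 e2'] := hib a; first by [].
  have [|e3 e3'] := hib (1 - 2 * k); first by [].
  by rewrite /Psi /psi e1 e1' e2 e2' e3 e3' /c1 /c2 /c3; split; field.
have [S SP] := stein_test_function dPsi psiK k0 lo hi e0.
exists S => s s01 sS /=; have H := SP s s01 sS.
by rewrite -!bernoulli_sumZ -bernoulli_sumB -bernoulli_sumD.
Qed.

Lemma bernoulli_sum_chebyshev (R : realType) (s : seq R) (B : R) :
  {in s, forall p, 0 <= p <= 1} -> 0 < Num.sqrt (\sum_(p <- s) p * (1 - p)) ->
  bernoulli_sum s (fun j => (standardize s j / B) ^+ 2) = (B ^+ 2)^-1.
Proof.
move=> s01 sd0; set v := \sum_(p <- s) p * (1 - p).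
have v0 : 0 < v by rewrite -sqrtr_gt0.
rewrite (bernoulli_sum_ext s (h := fun j => (v * B ^+ 2)^-1 * (j%:R - \sum_(p <- s) p) ^+ 2)).
  by rewrite bernoulli_sumZ bernoulli_sum_var // -/v invfM mulrAC mulVf ?mul1r // gt_eqF.
move=> j; rewrite /standardize -/v !expr_div_n sqr_sqrtr ?(ltW v0) // !invfM.
by ring.
Qed.

(** With u = Phi(x), the indicator of W <= x lies between 1 minus the ramp starting at u - k and 1
    minus the ramp starting at u. The mean of a ramp starting at a is nearly affine in a, close to 1
    at k and to 0 at 1 - 2 k, hence close to 1 - a. *)
Lemma bernoulli_clt (R : realType) (x e : R) : 0 < e ->
  exists S, forall s, {in s, forall p, 0 <= p <= 1} ->
    S <= Num.sqrt (\sum_(p <- s) p * (1 - p)) ->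
    `|bernoulli_sum s (fun j => (standardize s j <= x)%R%:R) - normal_cdf x| <= e.
Proof.
move=> e0; set u := normal_cdf x.
have u0 : 0 < u by exact: normal_cdf_gt0.
have u1 : u < 1 by exact: normal_cdf_lt1.
(* [r] is the error allowed in each Stein estimate and each Chebyshev tail; B >= 1 / r and B >= 1
   give 1 / B^2 <= r. *)
pose r := e / 8; have r0 : 0 < r by rewrite divr_gt0.
pose B := r^-1 + 1; have B1 : 1 <= B by rewrite lerDr invr_ge0 ltW.
have B0 : 0 < B by apply: lt_le_trans B1.
have Br : (B ^+ 2)^-1 <= r.
  rewrite -[r]invrK lef_pV2 ?posrE ?exprn_gt0 ?invr_gt0 //.
  apply: (@le_trans _ _ B); first by rewrite lerDl.
  by rewrite expr2 ler_pMr.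
(* The bounds by u and 1 - u place u - k and u between k and 1 - 2 k; those by Phi(-B) and Phi(B)
   force |W| >= B wherever the ramp at k is below 1 or the one at 1 - 2 k is above 0; the last one
   keeps the interpolation error below e. *)
pose k := Num.min (Num.min (u / 4) ((1 - u) / 4))
   (Num.min (Num.min (normal_cdf (- B) / 2) ((1 - normal_cdf B) / 2)) (e / 32)).
have k0 : 0 < k.
  by rewrite !lt_min !divr_gt0 ?subr_gt0 ?normal_cdf_gt0 ?normal_cdf_lt1.
have : k <= k by []; rewrite {2}/k !le_min -!andbA => /and5P[ku ku' kB kB' ke].
have [S1 H1] := @ramp_mean_affine R k u r k0 ltac:(lra) ltac:(lra) r0.
have [S2 H2] := @ramp_mean_affine R k (u - k) r k0 ltac:(lra) ltac:(lra) r0.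
exists (Num.max (Num.max S1 S2) 1) => s s01; rewrite !ge_max -andbA => /and3P[sd1 sd2 sd3].
have /= {}H1 := H1 s s01 sd1; have /= {}H2 := H2 s s01 sd2.
have sd0 := lt_le_trans ltr01 sd3; pose W := standardize s.
pose M b := bernoulli_sum s (fun j => ramp b k (normal_cdf (W j))).
have {H1} /ler_normlP[H1 H1'] := H1; have {H2} /ler_normlP[H2 H2'] := H2.
rewrite -/W -!/(M _) in H1 H1' H2 H2'.
have cheb := bernoulli_sum_chebyshev B s01 sd0.
have Bsq w : B <= `|w| -> 1 <= (w / B) ^+ 2.
  move=> Bw; rewrite expr_div_n ler_pdivlMr ?exprn_gt0 // mul1r.
  by rewrite -[w ^+ 2]real_normK ?num_real // lerXn2r ?nnegrE // ltW.
have Mlo : 1 - r <= M k.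
  apply: (@le_trans _ _ (1 - (B ^+ 2)^-1)); first by rewrite lerD2l lerN2.
  rewrite -cheb -[X in X - _](bernoulli_sum_cst s) -bernoulli_sumB.
  apply: ler_bernoulli_sum => // j; rewrite -/W; case: (leP (k + k) (normal_cdf (W j))) => Wk.
    by rewrite ramp_hi // gerBl sqr_ge0.
  have /Bsq : B <= `|W j|.
    have : normal_cdf (W j) < normal_cdf (- B) by lra.
    by rewrite ltr_normal_cdf ltrNr => /ltW /le_trans; apply; rewrite -normrN ler_norm.
  by have /andP[] := ramp_itv k (normal_cdf (W j)) k0; lra.
have Mhi : M (1 - 2 * k) <= r.
  apply: le_trans Br; rewrite -cheb.
  apply: ler_bernoulli_sum => // j; rewrite -/W; case: (leP (normal_cdf (W j)) (1 - 2 * k)) => Wk.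
    by rewrite ramp_lo // sqr_ge0.
  have /Bsq : B <= `|W j|.
    have : normal_cdf B < normal_cdf (W j) by lra.
    by rewrite ltr_normal_cdf => /ltW /le_trans; apply; rewrite ler_norm.
  by have /andP[] := ramp_itv (1 - 2 * k) (normal_cdf (W j)) k0; lra.
have M01 b : 0 <= M b <= 1.
  apply/andP; split; [rewrite -(bernoulli_sum_cst s 0)|rewrite -[leRHS](bernoulli_sum_cst s)].
    by apply: ler_bernoulli_sum => // j; have /andP[] := ramp_itv b (normal_cdf (W j)) k0.
  by apply: ler_bernoulli_sum => // j; have /andP[] := ramp_itv b (normal_cdf (W j)) k0.
set P := bernoulli_sum s _.
have Pup : P <= 1 - M u.
  rewrite -[X in X - _](bernoulli_sum_cst s) -bernoulli_sumB.
  apply: ler_bernoulli_sum => // j; rewrite -/W; case: (leP (W j) x) => Wx /=.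
    rewrite ramp_lo ?subr0 //; case: (ltgtP (W j) x) Wx => [/normal_cdf_lt/ltW//| |->//].
    by [].
  by rewrite subr_ge0; have /andP[] := ramp_itv u (normal_cdf (W j)) k0.
have Plo : 1 - M (u - k) <= P.
  rewrite -[X in X - _](bernoulli_sum_cst s) -bernoulli_sumB.
  apply: ler_bernoulli_sum => // j; rewrite -/W; case: (leP (W j) x) => Wx /=.
    by rewrite gerBl; have /andP[] := ramp_itv (u - k) (normal_cdf (W j)) k0.
  by rewrite ramp_hi ?subrr // subrK; apply/ltW/normal_cdf_lt.
have /andP[a1 a1'] := M01 u; have /andP[a2 a2'] := M01 (u - k).
have /andP[a3 a3'] := M01 k; have /andP[a4 a4'] := M01 (1 - 2 * k).
move: (M k) (M u) (M (u - k)) (M (1 - 2 * k)) H1 H1' H2 H2' Mlo Mhi Pup Plo a1 a1' a2 a2' a3 a3' a4 a4'.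
have er : e = 8 * r by rewrite /r; field.
clearbody r k u P; rewrite er in ke *; clear - k0 ku ku' ke r0 u0 u1.
move=> m1 m2 m2' m3 H1 H1' H2 H2' Mlo Mhi Pup Plo a1 a1' a2 a2' a3 a3' a4 a4'.
apply/ler_normlP; split; nra.
Qed.

(** * Transfer to coloured partitions *)

Lemma stirling_sum_colored_Bparts (R : comPzRingType) (n c m : nat) (g : nat -> R) :
  (0 < m)%N ->
  \sum_(o in colored_Bparts n c m) g (nonzero_blocks o) = stirling_sum c m n g.
Proof.
move=> m0; rewrite (sum_colored_Bparts _ _ m0); elim: n g => [|n IH] g.
  by rewrite /= big_seq1 /block_mins.
rewrite sum_words /= -IH; apply: eq_bigr => s _.
by rewrite mulr_natl.
Qed.

Lemma card_colored_Bparts (R : comPzRingType) (n c m : nat) (P : pred nat) :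
  (0 < m)%N ->
  #|[set o in colored_Bparts n c m | P (nonzero_blocks o)]|%:R =
  stirling_sum c m n (fun k => (P k)%:R) :> R.
Proof.
move=> m0; rewrite -stirling_sum_colored_Bparts // -sum1_card natr_sum.
rewrite big_mkcond [RHS]big_mkcond; apply: eq_bigr => o _ /=.
by rewrite inE; case: (_ \in _); case: P.
Qed.

(** The mean and variance of the number of non-zero-blocks are those of the Bernoulli sum, so the
    two standardizations coincide. The clause on squares carries the variance bound over to [s]. *)
Lemma xi_normalized_cdf_bernoulli (R : realType) (c m n : nat) :
  (0 < c)%N -> (0 < m)%N ->
  exists s : seq R, [/\ {in s, forall p, 0 <= p <= 1},
    forall mu, stirling_sum c m n (fun k => (k%:R - mu) ^+ 2) =
       stirling_sum c m n (fun=> 1) * bernoulli_sum s (fun k => (k%:R - mu) ^+ 2) &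
    forall x, xi_normalized_cdf n c m x =
       bernoulli_sum s (fun k => (standardize s k <= x)%R%:R)].
Proof.
move=> c0 m0; have [s [s01 sE]] := stirling_sum_bernoulli R c m n.
have T0 : stirling_sum c m n (fun=> 1 : R) != 0 by rewrite gt_eqF ?stirling_sum1_gt0.
have card : #|colored_Bparts n c m|%:R = stirling_sum c m n (fun=> 1 : R).
  by rewrite -stirling_sum_colored_Bparts // sumr_const.
exists s; split=> // x.
have mean : xi_mean R n c m = \sum_(p <- s) p.
  rewrite /xi_mean card (stirling_sum_colored_Bparts _ _ (fun k => k%:R)) // sE.
  by rewrite mulrAC divff // mul1r bernoulli_sum_mean.
have var : xi_var R n c m = \sum_(p <- s) p * (1 - p).
  rewrite /xi_var card mean.
  rewrite (stirling_sum_colored_Bparts _ _ (fun k => (k%:R - \sum_(p <- s) p) ^+ 2)) // sE.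
  by rewrite mulrAC divff // mul1r bernoulli_sum_var.
rewrite /xi_normalized_cdf card mean var -/(standardize s _).
rewrite (card_colored_Bparts R n c (fun k => standardize s k <= x)) // sE.
by rewrite mulrAC divff // mul1r.
Qed.

(* Convergence in distribution to N(0,1): the CDFs converge at every point
   (the limit CDF is continuous everywhere). *)
Theorem theorem7 (R : realType) (c m : nat) (hc : (0 < c)%N) (hm : (0 < m)%N) :
  forall x : R,
    (fun n : nat => (@xi_normalized_cdf R n c m x)%:E) @ \oo -->
      normal_prob (0 : R) 1 `]-oo, x].
Proof.
move=> x; rewrite normal_prob_cdf; apply: cvg_EFin; first by near=> n.
apply/cvgrPdist_le => /= e e0.
have [S SP] := bernoulli_clt x e0.
(* A variance of at least S^2 makes the standard deviation at least |S|, hence at least [S], whose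
   sign is unknown. *)
have [N NP] := stirling_variance_large (S ^+ 2) hc hm.
exists N => // n /= Nn; rewrite distrC.
have [s [s01 sV ->]] := xi_normalized_cdf_bernoulli R n hc hm.
apply: SP => //; have := NP n Nn (\sum_(p <- s) p).
rewrite sV bernoulli_sum_var // mulrC ler_pM2l ?stirling_sum1_gt0 // => SV.
apply: le_trans (ler_norm S) _; rewrite -sqrtr_sqr.
by rewrite ler_wsqrtr.
Unshelve. all: by end_near. Qed.
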